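(* Let $M\ge N\ge 1$ be integers, $\nu=M-N$, and for $\mu\in(0,1)$ let $P(y_1,\ldots,y_N)=P^{(\mu)}(y_1,\ldots,y_N)$ be the density given in the context. Then for $y_1,\ldots,y_N>0$ $$\lim_{\mu\to 1}P(y_1,\ldots,y_N)=\frac{\det\left[y_i^{j-1}\right]_{i,j=1}^N}{N!\prod_{j=1}^N\Gamma(j)^2\Gamma(j+\nu)}\det\left[G^{2,0}_{0,2}\left(\begin{array}{c}-\\0,\,j+\nu-1\end{array}\Big|\,y_i\right)\right]_{i,j=1}^N$$ and $$\lim_{\mu\to 0}P(y_1,\ldots,y_N)=\frac{2^{N(M-1)}}{N!\prod_{j=1}^N\Gamma(j)\Gamma(j+\nu)}\left(\det\left[y_i^{\frac{j-1}{2}}\right]_{i,j=1}^N\right)^2\prod_{i=1}^Ny_i^{\frac{\nu-1}{2}}\exp\left[-2y_i^{\frac12}\right].$$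
   Context: For $\mu\in(0,1)$ put $\alpha(\mu)=\frac{1+\mu}{2\mu}$, $\delta(\mu)=\frac{1-\mu}{2\mu}$. The density (it is the joint density of the squared singular values of the product of two $\mu$-dependent Gaussian complex random matrices of sizes $N\times M$ and $M\times N$) is $$P(y_1,\ldots,y_N)=\frac{1}{Z_N}\det\left[y_i^{\frac{j-1}{2}}I_{j-1}\left(2\delta(\mu)\sqrt{y_i}\right)\right]_{i,j=1}^N\det\left[y_i^{\frac{j+\nu-1}{2}}K_{j+\nu-1}\left(2\alpha(\mu)\sqrt{y_i}\right)\right]_{i,j=1}^N,$$ $$Z_N=\frac{N!\,\alpha(\mu)^{N\nu+\frac{N(N-1)}{2}}\delta(\mu)^{\frac{N(N-1)}{2}}}{2^N\left(\alpha(\mu)^2-\delta(\mu)^2\right)^{N\nu+N^2}}\prod_{j=1}^N\Gamma(j)\Gamma(j+\nu),$$ where $I_\kappa$, $K_\kappa$ are the modified Bessel functions of the first and second kind. The Meijer G-function occurring here satisfies $G^{2,0}_{0,2}\left(\begin{array}{c}-\\0,\,l\end{array}\Big|\,y\right)=2y^{l/2}K_l(2\sqrt y)$ for $y>0$; equivalently it equals $\frac{1}{2\pi i}\int_{c-i\infty}^{c+i\infty}\Gamma(s)\Gamma(s+l)y^{-s}ds$ with $c>0$. *)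

(* Defs.v *)
From HB Require Import structures.
From mathcomp Require Import all_boot all_order all_algebra.
From mathcomp Require Import complex.
From mathcomp Require Import all_classical all_reals all_analysis.

Set Implicit Arguments.
Unset Strict Implicit.
Unset Printing Implicit Defensive.

Import Order.TTheory GRing.Theory Num.Theory.
Import numFieldNormedType.Exports.

Local Open Scope classical_set_scope.
Local Open Scope complex_scope.
Local Open Scope ring_scope.

Section SpecialFunctions.
Variable R : realType.
Local Notation leb := (@lebesgue_measure R).

Definition cosh (t : R) : R := (expR t + expR (- t)) / 2.

(* Euler integral; meaningful for x > 0. *)
Definition Gamma (x : R) : R :=
  \int[leb]_(t in `]0, +oo[) (t `^ (x - 1) * expR (- t)).

(* Modified Bessel function of the first kind I_n(x), of integer order n >= 0,
   by its power series. *)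
Definition besselI (n : nat) (x : R) : R :=
  limn (series (fun k : nat => (x / 2) ^+ (2 * k + n) / (k`! * (k + n)`!)%:R)).

(* Modified Bessel function of the second kind K_n(x), of integer order n >= 0,
   by the integral of exp(- x cosh t) cosh(n t) over t >= 0, which converges
   exactly for x > 0. *)
Definition besselK (n : nat) (x : R) : R :=
  \int[leb]_(t in `[0, +oo[) (expR (- (x * cosh t)) * cosh (n%:R * t)).

(* Integral of a complex-valued function: real and imaginary parts apart. *)
Definition Cintegral (D : set R) (f : R -> R[i]) : R[i] :=
  (\int[leb]_(t in D) complex.Re (f t)) +i* (\int[leb]_(t in D) complex.Im (f t)).

(* t ^ s := exp (s ln t) for a positive base t and a complex exponent s. *)
Definition cpow (t : R) (s : R[i]) : R[i] :=
  (expR (complex.Re s * ln t))%:C *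
  (cos (complex.Im s * ln t) +i* sin (complex.Im s * ln t)).

(* Euler integral; meaningful for Re s > 0. *)
Definition CGamma (s : R[i]) : R[i] :=
  Cintegral `]0, +oo[ (fun t => cpow t (s - 1) * (expR (- t))%:C).

(* The Meijer G-function G^{2,0}_{0,2}(- ; b1, b2 | y) for y > 0, as the
   Mellin-Barnes integral
     1/(2 pi i) int_{c - i oo}^{c + i oo} Gamma(b1 + s) Gamma(b2 + s) y^(-s) ds
   along the line s = c + i tau, on which ds = i dtau.  The line must lie to the
   right of the poles of the integrand, i.e. c > - b1 and c > - b2. *)
Definition meijerG2002 (c b1 b2 y : R) : R[i] :=
  ((2 * pi)^-1)%:C *
  Cintegral setT (fun tau =>
    let s := c +i* tau in
    CGamma (b1%:C + s) * CGamma (b2%:C + s) * cpow y (- s)).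

End SpecialFunctions.

Section Density.
Variable R : realType.

Definition alpha (mu : R) : R := (1 + mu) / (2 * mu).

Definition delta (mu : R) : R := (1 - mu) / (2 * mu).

(* Indices i, j : 'I_N start at 0, so j below is the usual j - 1. *)

Definition ZN (N nu : nat) (mu : R) : R :=
  N`!%:R * alpha mu ^+ (N * nu + (N * N.-1) %/ 2)
         * delta mu ^+ ((N * N.-1) %/ 2)
  / (2 ^+ N * (alpha mu ^+ 2 - delta mu ^+ 2) ^+ (N * nu + N ^ 2))
  * \prod_(j < N) (Gamma (R := R) j.+1%:R * Gamma (R := R) (j.+1 + nu)%:R).

Definition density (N nu : nat) (mu : R) (y : 'I_N -> R) : R :=
  (ZN N nu mu)^-1
  * \det (\matrix_(i < N, j < N)
      (y i `^ (j%:R / 2) * besselI j (2 * delta mu * Num.sqrt (y i))))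
  * \det (\matrix_(i < N, j < N)
      (y i `^ ((j + nu)%:R / 2)
       * besselK (j + nu) (2 * alpha mu * Num.sqrt (y i)))).

End Density.

(* Main.v *)
Require Import Defs.
From HB Require Import structures.
From mathcomp Require Import all_boot all_order all_algebra.
From mathcomp Require Import complex.
From mathcomp Require Import all_classical all_reals all_analysis.
From mathcomp Require Import measurable_realfun.
From mathcomp Require Import zify ring lra.

Set Implicit Arguments.
Unset Strict Implicit.
Unset Printing Implicit Defensive.

Import Order.TTheory GRing.Theory Num.Theory.
Import numFieldNormedType.Exports.

Local Open Scope classical_set_scope.
Local Open Scope complex_scope.
Local Open Scope ring_scope.

(** As mu -> 1 the arguments of the I_j tend to 0 and only the leading term of
    their power series survives, while K is continuous; it remains to identify
    2 y^(l/2) K_l(2 sqrt y) with the Mellin-Barnes integral.  With t = exp u,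
    Gamma(c + i tau) is the Fourier transform of phi_c(u) = exp(c u - exp u), so
    Gamma(c + i tau) Gamma(c + l + i tau) is the transform of a convolution that
    equals the Bessel function.  Fourier inversion applies because
    Gamma(s + 1) = s Gamma(s) gives |Gamma(c + i tau)| = O(1 / tau^2).

    As mu -> 0 all arguments tend to infinity and Laplace's method on
    I_n(x) = 1/pi int_0^pi exp(x cos t) cos(n t) dt and on the integral of K_n,
    with x = 2 / r^2 and t = r u, reduces both to the Gaussian integral; the
    exponentials combine since alpha - delta = 1. *)

(** * Integrals on the line *)

(** At both ends the degeneration sits in the factors, not in the limiting determinants. Near mu = 1
    the constant Z_N vanishes like delta^(N(N-1)/2), which is exactly the product of the column
    factors delta^j released by the I_j. Near mu = 0 the leading terms of I_j and K_j do not depend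
    on j; it is the powers y_i^(j/2) in front that turn each determinant into a Vandermonde
    determinant in sqrt y_i. Since alpha^2 - delta^2 = 1 / mu, the powers of mu in Z_N amount to
    mu^N, one per row, and meet the same power from the Bessel prefactors. Decay 1 / |tau| of Gamma
    on the vertical line would not be integrable, so the functional equation is applied twice. The
    complex integral is defined through real and imaginary parts, hence all transforms are handled
    as pairs of a cosine and a sine integral. The imaginary part of the Mellin-Barnes integrand is
    odd in tau and integrates to 0. The abscissa c disappears because the factor exp(- c ln y) of
    y^(-s) cancels the factor exp(c ln y) of the convolution. *)

Section Continuity.
Variable R : realType.
Implicit Types (f g : R -> R) (x : R).

Lemma cont_add f g x : continuous_at x f -> continuous_at x g ->
  continuous_at x (fun t => f t + g t).
Proof. by move=> cf cg; exact: (@cvgD _ _ _ _ _ f g _ _ cf cg). Qed.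

Lemma cont_mul f g x : continuous_at x f -> continuous_at x g ->
  continuous_at x (fun t => f t * g t).
Proof. by move=> cf cg; exact: (@cvgM _ _ _ _ f g _ _ cf cg). Qed.

Lemma cont_inv f x : f x != 0 -> continuous_at x f ->
  continuous_at x (fun t => (f t)^-1).
Proof. by move=> f0 cf; exact: (@cvgV _ _ _ _ f _ f0 cf). Qed.

Lemma cont_opp f x : continuous_at x f -> continuous_at x (fun t => - f t).
Proof. by move=> cf; exact: (@cvgN _ _ _ _ _ f _ cf). Qed.

Lemma cont_exprn f n x : continuous_at x f -> continuous_at x (fun t => f t ^+ n).
Proof.
move=> cf; exact: (@continuous_comp _ _ _ f (fun y => y ^+ n) x cf (@exprn_continuous _ n _)).
Qed.

Lemma cont_comp f (h : R -> R) x : continuous h -> continuous_at x f ->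
  continuous_at x (fun t => h (f t)).
Proof. by move=> ch cf; exact: (@continuous_comp _ _ _ f h x cf (ch _)). Qed.

Lemma continuous_normr : continuous (fun t : R => `|t|).
Proof. by move=> x; exact: norm_continuous. Qed.

End Continuity.

(** The last case accepts any head function whose continuity is a hypothesis; this is why later
    proofs bring facts such as [continuous_cosh] into the context before calling [cont]. *)
Ltac cont_step :=
  first [exact: cvg_cst | lazymatch goal with
  | |- continuous_at _ (fun t => t) => exact: cvg_id
  | |- continuous_at _ (fun t => (@?f t + @?g t)%R) => refine (@cont_add _ f g _ _ _)
  | |- continuous_at _ (fun t => (@?f t * @?g t)%R) => refine (@cont_mul _ f g _ _ _)
  | |- continuous_at _ (fun t => (- (@?f t))%R) => refine (@cont_opp _ f _ _)
  | |- continuous_at _ (fun t => (@?f t ^+ ?n)%R) => refine (@cont_exprn _ f n _ _)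
  | |- continuous_at _ (fun t => expR (@?f t)) =>
      refine (@cont_comp _ f (@expR _) _ (@continuous_expR _) _)
  | |- continuous_at _ (fun t => cos (@?f t)) =>
      refine (@cont_comp _ f (@cos _) _ (@continuous_cos _) _)
  | |- continuous_at _ (fun t => sin (@?f t)) =>
      refine (@cont_comp _ f (@sin _) _ (@continuous_sin _) _)
  | |- continuous_at _ (fun t => `| @?f t |%R) =>
      refine (@cont_comp _ f _ _ (@continuous_normr _) _)
  | |- continuous_at _ (fun t => ?h (@?f t)) =>
      refine (@cont_comp _ f h _ _ _); [assumption|]
  end].

Ltac cont :=
  let x := fresh "x" in
  lazymatch goal with
  | |- continuous_at _ _ => idtac
  | |- {for _, continuous _} => rewrite /prop_for
  | |- _ => move=> x
  end; repeat cont_step.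

Section RealIntegrals.
Variable R : realType.
Local Notation leb := (@lebesgue_measure R).
Local Notation L1 f := (leb.-integrable setT (EFin \o f)).

Lemma dominated_cvg_Rintegral (D : set R) (f_ : nat -> R -> R) (f g : R -> R) :
  measurable D -> (forall n, measurable_fun D (f_ n)) ->
  (forall x, D x -> f_ n x @[n --> \oo] --> f x) ->
  leb.-integrable D (EFin \o g) ->
  (forall n x, D x -> `|f_ n x| <= g x) ->
  \int[leb]_(x in D) f_ n x @[n --> \oo] --> \int[leb]_(x in D) f x.
Proof.
move=> mD mf_ ff ig fg.
have mE n : measurable_fun D (EFin \o f_ n).
  by apply/measurable_EFinP; exact: mf_.
have cE x : D x -> (EFin \o f_ n) x @[n --> \oo] --> (EFin \o f) x.
  by move=> Dx; apply: cvg_EFin; [exact: nearW|exact: ff].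
have mf : measurable_fun D (EFin \o f).
  apply: (emeasurable_fun_cvg (fun n => EFin \o f_ n)) => //.
have [] := @dominated_convergence _ _ _ leb D mD (fun n => EFin \o f_ n)
  (EFin \o f) (EFin \o g).
- exact: mE.
- exact: mf.
- by apply: aeW => x Dx; exact: cE.
- exact: ig.
- by apply: aeW => x n Dx; rewrite /= lee_fin; exact: fg.
move=> i1 _ c.
have fi : (\int[leb]_(x in D) (EFin \o f) x)%E \is a fin_num
  by exact: integrable_fin_num.
apply: fine_cvg; rewrite fineK//.
Qed.

Lemma le_L1 (D : set R) (f g : R -> R) : measurable D -> measurable_fun D f ->
  leb.-integrable D (EFin \o g) -> (forall x, D x -> `|f x| <= g x) ->
  leb.-integrable D (EFin \o f).
Proof.
move=> mD mf ig fg; have mE : measurable_fun D (EFin \o f) by exact/measurable_EFinP.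
apply: le_integrable ig => // x Dx.
by rewrite /= lee_fin (le_trans (fg _ Dx))// ler_norm.
Qed.

(** A majorant that is a product of integrable functions of one variable makes F integrable on the
    plane by Tonelli. In the uses below one factor controls the frequency and the other the space
    variable. *)
Lemma Fubini_Rintegral (F : R * R -> R) (g h : R -> R) :
  measurable_fun setT F -> L1 g -> L1 h ->
  (forall x y, `|F (x, y)| <= g x * h y) ->
  \int[leb]_x \int[leb]_y F (x, y) = \int[leb]_y \int[leb]_x F (x, y).
Proof.
move=> mF ig ih Fgh.
have mFx x : measurable_fun setT (fun y => F (x, y)).
  by apply: measurableT_comp mF _; exact: measurable_pair1.
have mFy y : measurable_fun setT (fun x => F (x, y)).
  by apply: measurableT_comp mF _; exact: measurable_pair2.
have mg : measurable_fun setT g by move/measurable_int/measurable_EFinP : ig.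
have mh : measurable_fun setT h by move/measurable_int/measurable_EFinP : ih.
have iFx x : L1 (fun y => F (x, y)).
  apply: (@le_L1 _ _ (fun y => g x * h y)) => //.
  by apply: (integrableZl measurableT (g x) ih).
have iFy y : L1 (fun x => F (x, y)).
  apply: (@le_L1 _ _ (fun x => g x * h y)) => //.
  by apply: (integrableZr measurableT (h y) ig).
have iF : (leb \x leb)%E.-integrable setT (EFin \o F).
  apply/integrable12ltyP; first exact/measurable_EFinP.
  have hfin : (\int[leb]_y `|h y|%:E)%E \is a fin_num.
    exact: (integrable_fin_num measurableT (integrable_norm ih)).
  have gfin : (\int[leb]_y `|g y|%:E)%E \is a fin_num.
    exact: (integrable_fin_num measurableT (integrable_norm ig)).
  set H := fine (\int[leb]_y `|h y|%:E)%E.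
  have H0 : 0 <= H by rewrite fine_ge0// integral_ge0.
  apply: (@le_lt_trans _ _ (\int[leb]_x (`|g x|%:E * H%:E))%E).
    apply: ge0_le_integral => //.
    - by move=> x _; exact: integral_ge0.
    - apply: (@measurable_fun_fubini_tonelli_F _ _ _ _ _ leb (abse \o (EFin \o F))) => /=.
        by apply/measurableT_comp => //; exact/measurable_EFinP.
      by move=> z; rewrite lee_fin.
    - suff M : measurable_fun setT (EFin \o (fun x => `|g x| * H)) by exact: M.
      by apply/measurable_EFinP/measurable_funM => //; exact: measurableT_comp.
    - move=> x _; rewrite fineK// -ge0_integralZl//; last first.
        by apply/measurable_EFinP; exact: measurableT_comp.
      apply: ge0_le_integral => //=.
      + suff M : measurable_fun setT (EFin \o (fun y => `|F (x, y)|)) by exact: M.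
        by apply/measurable_EFinP; exact: measurableT_comp.
      + suff M : measurable_fun setT (EFin \o (fun y => `|g x| * `|h y|)) by exact: M.
        by apply/measurable_EFinP/measurable_funM => //; apply: measurableT_comp.
      + by move=> y _; rewrite lee_fin (le_trans (Fgh _ _))// -normrM ler_norm.
  rewrite ge0_integralZr//=; last first.
  - by apply/measurable_EFinP; exact: measurableT_comp.
  by rewrite -(fineK gfin) -EFinM ltry.
have := Fubini iF; rewrite /Rintegral => E.
under eq_integral => x _ do rewrite fineK ?(integrable_fin_num _ (iFx x))//.
under [in RHS]eq_integral => x _ do rewrite fineK ?(integrable_fin_num _ (iFy x))//.
by congr fine.
Qed.

(** Reduces a change of variable for a signed integrand to the nonnegative case, as an identity
    between extended reals. *)
Lemma integral_posneg (D : set R) (f : R -> R) :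
  (\int[leb]_(x in D) (f x)%:E =
   \int[leb]_(x in D) (Num.max (f x) 0)%:E
   - \int[leb]_(x in D) (Num.max (- f x) 0)%:E)%E.
Proof.
rewrite integralE; congr (_ - _)%E; apply: eq_integral => x _.
  by rewrite funeposE EFin_max.
by rewrite funenegE EFin_max.
Qed.

Lemma continuous_maxr0 (f : R -> R) (x : R) : {for x, continuous f} ->
  {for x, continuous (fun t => Num.max (f t) 0)}.
Proof. by move=> cf; apply: continuous_max => //; exact: cst_continuous. Qed.

Lemma continuous_maxNr0 (f : R -> R) (x : R) : {for x, continuous f} ->
  {for x, continuous (fun t => Num.max (- f t) 0)}.
Proof.
move=> cf; apply: (@continuous_maxr0 (fun t => - f t)).
exact: continuousN.
Qed.

Lemma integral_affine (f : R -> R) (a b : R) : continuous f -> 0 < b ->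
  (\int[leb]_x (f x)%:E = \int[leb]_x (f (a + b * x) * b)%:E)%E.
Proof.
move=> cf b0.
pose F x := a + b * x.
have dF (x : R) : is_derive x 1 F b.
  by rewrite /F; apply: is_derive_eq; rewrite /GRing.scale/=; ring.
have F'E : derive1 F = cst b.
  by apply/funext => x; rewrite derive1E derive_val.
have H (g : R -> R) : continuous g -> (forall x, 0 <= g x) ->
    (\int[leb]_x (g x)%:E = \int[leb]_x (g (a + b * x) * b)%:E)%E.
  move=> cg g0.
  rewrite (@increasing_ge0_integration_by_substitutionT _ F g)//.
  - by apply: eq_integral => x _; rewrite F'E.
  - by move=> x y xy; rewrite /F ltrD2l ltr_pM2l.
  - by rewrite F'E => x; exact: cst_continuous.
  - by rewrite F'E; exact: is_cvg_cst.
  - by rewrite F'E; exact: is_cvg_cst.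
  - apply/cvgrNyPle => A; near=> x; rewrite /F -lerBrDl mulrC -ler_pdivlMr//.
  - apply/cvgryPge => A; near=> x; rewrite /F -lerBlDl mulrC -ler_pdivrMr//.
rewrite integral_posneg [RHS]integral_posneg; congr (_ - _)%E.
- rewrite H; last 2 first.
  + by move=> x; apply: continuous_maxr0; exact: cf.
  + by move=> x; rewrite le_max lexx orbT.
  by apply: eq_integral => x _; rewrite maxr_pMl ?mul0r// ltW.
- rewrite H; last 2 first.
  + by move=> x; apply: continuous_maxNr0; exact: cf.
  + by move=> x; rewrite le_max lexx orbT.
  by apply: eq_integral => x _; rewrite maxr_pMl ?mul0r ?mulNr// ltW.
Unshelve. all: by end_near.
Qed.

Lemma ge0_integralT_split (G : R -> R) : continuous G -> (forall x, 0 <= G x) ->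
  (\int[leb]_x (G x)%:E =
   \int[leb]_(x in `]-oo, 0%R]) (G x)%:E + \int[leb]_(x in `[0%R, +oo[) (G x)%:E)%E.
Proof.
move=> cG G0.
have mG : measurable_fun setT G by exact: continuous_measurable_fun.
rewrite -{1}setC0 -(set_itvoc0 0%R) setCitv/= ge0_integral_setU//=; first last.
- rewrite disj_set2E; apply/eqP; rewrite -subset0 => x []/= /[!in_itv]/=.
  by rewrite leNgt andbT => /negP.
- by move=> x _; rewrite lee_fin.
- by apply/measurable_EFinP; apply: measurable_funS mG.
rewrite integral_itv_obnd_cbnd//.
by apply/measurable_EFinP; apply: measurable_funS mG.
Qed.

Lemma integral_reflect (f : R -> R) : continuous f ->
  (\int[leb]_x (f x)%:E = \int[leb]_x (f (- x))%:E)%E.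
Proof.
move=> cf.
have cN (g : R -> R) : continuous g -> continuous (g \o -%R).
  by move=> cg x; apply: continuous_comp; [exact: opp_continuous|exact: cg].
have H (g : R -> R) : continuous g -> (forall x, 0 <= g x) ->
    (\int[leb]_x (g x)%:E = \int[leb]_x (g (- x))%:E)%E.
  move=> cg g0.
  rewrite (ge0_integralT_split cg)// (ge0_integralT_split (cN _ cg)); last first.
    by move=> x; exact: g0.
  rewrite addeC -{2 3}oppr0; congr (_ + _)%E; last first.
    by rewrite ge0_integration_by_substitutionNy//; exact: continuous_subspaceT.
  rewrite ge0_integration_by_substitutionNy//; last 2 first.
    by apply: continuous_subspaceT; exact: cN.
    by move=> x _; exact: g0.
  by apply: eq_integral => x _ /=; rewrite opprK.
rewrite integral_posneg [RHS]integral_posneg; congr (_ - _)%E.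
- rewrite H// => x.
  + by apply: continuous_maxr0; exact: cf.
  + by rewrite le_max lexx orbT.
- rewrite H// => x.
  + by apply: continuous_maxNr0; exact: cf.
  + by rewrite le_max lexx orbT.
Qed.

(** Reflection shows that the positive and negative parts have the same integral A, and
    [fine (A - A)] is 0 for finite as well as infinite A. *)
Lemma Rintegral_odd (f : R -> R) : continuous f -> (forall x, f (- x) = - f x) ->
  \int[leb]_x f x = 0.
Proof.
move=> cf fN; rewrite /Rintegral integral_posneg.
rewrite [X in (X - _)%E]integral_reflect; last first.
  by move=> x; apply: continuous_maxr0; exact: cf.
under eq_integral => x _ do rewrite fN.
set A := (\int[leb]_x _)%E.
by case: A => [r| |]//=; rewrite subrr.
Qed.

Lemma integral_expR (f : R -> R) : {in `]0, +oo[, continuous f} ->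
  (\int[leb]_(x in `]0%R, +oo[) (f x)%:E = \int[leb]_x (f (expR x) * expR x)%:E)%E.
Proof.
move=> cf.
have H (g : R -> R) : {in `]0, +oo[, continuous g} -> (forall x, 0 <= g x) ->
    (\int[leb]_(x in `]0%R, +oo[) (g x)%:E
      = \int[leb]_x (g (expR x) * expR x)%:E)%E.
  move=> cg g0.
  have cge : continuous (fun x => g (expR x) * expR x).
    move=> x; apply: continuousM; last exact: continuous_expR.
    apply: continuous_comp; first exact: continuous_expR.
    by apply: cg; rewrite in_itv/= andbT expR_gt0.
  have mg : measurable_fun (`]0%R, +oo[ : set R) g.
    by apply: open_continuous_measurable_fun => // x; rewrite inE; exact: cg.
  (* The substitution is made on the compact intervals [E n], which exp maps onto [D n]; monotone
     convergence along both exhaustions then gives the integrals over the ray and the line. *)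
  pose D (n : nat) := `[expR (- n%:R), expR n%:R : R]%classic.
  pose E (n : nat) := `[- n%:R, n%:R : R]%classic.
  have DE : \bigcup_n D n = `]0, +oo[%classic.
    apply/seteqP; split => x /=.
      move=> [n _]; rewrite /D/= !in_itv/= andbT => /andP[+ _].
      by apply: lt_le_trans; exact: expR_gt0.
    rewrite in_itv/= andbT => x0.
    exists (Num.truncn `|ln x|).+1 => //; rewrite /D/= in_itv/=.
    set k := (_.+1).
    suff : expR (- k%:R) <= expR (ln x) <= expR k%:R by rewrite lnK.
    by rewrite !ler_expR -ler_norml ltW// truncnS_gt.
  have EE : \bigcup_n E n = setT.
    apply/seteqP; split => x //= _.
    exists (Num.truncn `|x|).+1 => //; rewrite /E/= in_itv/=.
    by rewrite -ler_norml ltW// truncnS_gt.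
  have nn n : - n%:R <= n%:R :> R by rewrite (@le_trans _ _ 0)// oppr_le0.
  have c1 : (\int[leb]_(x in D n) (g x)%:E)%E @[n --> \oo] -->
      (\int[leb]_(x in `]0%R, +oo[) (g x)%:E)%E.
    rewrite -DE; apply: ge0_nondecreasing_set_cvg_integral => //.
    - move=> m n mn; apply/subsetPset => x; rewrite /D/= !in_itv/= => /andP[h1 h2].
      by rewrite (le_trans _ h1) ?(le_trans h2)// ler_expR ?lerN2 ler_nat.
    - move=> n; exact: measurable_itv.
    - move=> n; apply/measurable_EFinP; apply: measurable_funS mg => //.
      by rewrite -DE; exact: bigcup_sup.
    - by move=> n x _; rewrite lee_fin.
  have c2 : (\int[leb]_(x in E n) (g (expR x) * expR x)%:E)%E @[n --> \oo] -->
      (\int[leb]_x (g (expR x) * expR x)%:E)%E.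
    rewrite -EE; apply: ge0_nondecreasing_set_cvg_integral => //.
    - move=> m n mn; apply/subsetPset => x; rewrite /E/= !in_itv/= => /andP[h1 h2].
      by rewrite (le_trans _ h1) ?(le_trans h2)// ?lerN2 ler_nat.
    - move=> n; exact: measurable_itv.
    - move=> n; apply/measurable_EFinP; apply: measurable_funTS.
      exact: continuous_measurable_fun.
    - by move=> n x _; rewrite lee_fin mulr_ge0// expR_ge0.
  suff E12 : (fun n => \int[leb]_(x in D n) (g x)%:E)%E
      = (fun n => \int[leb]_(x in E n) (g (expR x) * expR x)%:E)%E.
    by rewrite E12 in c1; apply: cvg_unique c1 c2.
  have dE : derive1 (@expR R) = expR.
    by apply/funext => x; rewrite derive1E; exact: derive_val.
  apply/funext => n; rewrite /D integration_by_substitution_increasing//.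
  - by apply: eq_integral => x _; rewrite /= dE.
  - by move=> x y _ _; rewrite ltr_expR.
  - by move=> x _; rewrite dE; exact: continuous_expR.
  - by rewrite dE; apply/cvg_ex; exists (expR (- n%:R)); apply: cvg_at_right_filter; exact: continuous_expR.
  - by rewrite dE; apply/cvg_ex; exists (expR (n%:R)); apply: cvg_at_left_filter; exact: continuous_expR.
  - split.
    + by move=> x _; exact: derivable_expR.
    + by apply: cvg_at_right_filter; exact: continuous_expR.
    + by apply: cvg_at_left_filter; exact: continuous_expR.
  - apply: continuous_in_subspaceT => x; rewrite inE/= in_itv/= => /andP[h _].
    by apply: cg; rewrite in_itv/= andbT (lt_le_trans _ h)// expR_gt0.
rewrite integral_posneg [RHS]integral_posneg; congr (_ - _)%E.
- rewrite H.
  + by apply: eq_integral => x _; rewrite maxr_pMl ?mul0r ?expR_ge0.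
  + by move=> x x0; apply: continuous_maxr0; exact: cf.
  + by move=> x; rewrite le_max lexx orbT.
- rewrite H.
  + by apply: eq_integral => x _; rewrite maxr_pMl ?mul0r ?mulNr ?expR_ge0.
  + by move=> x x0; apply: continuous_maxNr0; exact: cf.
  + by move=> x; rewrite le_max lexx orbT.
Qed.

End RealIntegrals.

(** * Transform of exp(- e |x|) and the Cauchy integral *)

Section ExpIntegrals.
Variable R : realType.
Local Notation leb := (@lebesgue_measure R).
Local Notation L1 f := (leb.-integrable setT (EFin \o f)).

Lemma cvg_mul_expRN (e C : R) (g : R -> R) : 0 < e -> (forall x, `|g x| <= C) ->
  expR (- (e * x)) * g x @[x --> +oo] --> (0 : R).
Proof.
move=> e0 gC.
have h : C * expR (- (e * x)) @[x --> +oo] --> (0 : R).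
  rewrite -(mulr0 C); apply: cvgMr.
  apply: (@cvg_comp _ _ _ (fun x => e * x) (fun x => expR (- x)) _ +oo); last exact: cvgr_expR.
  apply/cvgryPge => A; near=> x; rewrite mulrC -ler_pdivrMr//.
apply/norm_cvg0P; apply: (squeeze_cvgr _ (cvg_cst (0 : R)) h).
near=> x => /=; rewrite normr_ge0/= normrM (ger0_norm (expR_ge0 _)) mulrC.
by rewrite ler_wpM2r// expR_ge0.
Unshelve. all: by end_near.
Qed.

(* The summand 1 makes the integrand nonnegative. *)
Lemma integral_exp_1Dcos (e w : R) : 0 < e ->
  (\int[leb]_(x in `[0%R, +oo[) (expR (- (e * x)) * (1 + cos (w * x)))%:E
   = (e^-1 + e / (e ^+ 2 + w ^+ 2))%:E)%E.
Proof.
move=> e0.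
have ew0 : e ^+ 2 + w ^+ 2 != 0 by rewrite gt_eqF// ltr_pwDl ?sqr_ge0// exprn_gt0.
(* Chosen so that exp(- e x) g x is a primitive of the integrand; it vanishes at infinity because g
   is bounded, so the integral is - g 0. *)
pose g x := - e^-1 + (w * sin (w * x) - e * cos (w * x)) / (e ^+ 2 + w ^+ 2).
pose F x := expR (- (e * x)) * g x.
have dF (x : R) : is_derive x 1 F (expR (- (e * x)) * (1 + cos (w * x))).
  rewrite /F /g; apply: is_derive_eq; rewrite /GRing.scale/=.
  by field; rewrite ew0 gt_eqF.
have gb x : `|g x| <= e^-1 + (`|w| + e) / (e ^+ 2 + w ^+ 2).
  rewrite /g (le_trans (ler_normD _ _))// lerD//.
    by rewrite normrN ger0_norm// invr_ge0 ltW.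
  rewrite normrM normfV (@ger0_norm _ (e ^+ 2 + w ^+ 2)) ?addr_ge0 ?sqr_ge0//.
  rewrite ler_wpM2r ?invr_ge0 ?addr_ge0 ?sqr_ge0//.
  rewrite (le_trans (ler_normB _ _))// lerD// normrM.
    by rewrite ler_piMr// sin_max.
  by rewrite (ger0_norm (ltW e0)) ler_piMr ?(ltW e0)// cos_max.
have F'E x : derive1 F x = expR (- (e * x)) * (1 + cos (w * x)).
  by rewrite derive1E derive_val.
have cF x : {for x, continuous F}.
  by apply/differentiable_continuous/derivable1_diffP.
rewrite (@ge0_continuous_FTC2y _ (fun x => expR (- (e * x)) * (1 + cos (w * x))) F 0 0).
- rewrite /F /g !mulr0 oppr0 expR0 sin0 cos0 -EFinB; congr EFin.
  by field; rewrite ew0 gt_eqF.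
- by move=> x _; rewrite mulr_ge0 ?expR_ge0// -lerBlDl sub0r cos_geN1.
- by apply: continuous_subspaceT; cont.
- exact: cvg_mul_expRN.
- by move=> x _.
- by apply: cvg_at_right_filter; exact: cF.
- by move=> x _; rewrite F'E.
Qed.

Lemma continuous_expNMabs (e : R) : continuous (fun x : R => expR (- (e * `|x|))).
Proof. by cont. Qed.

Lemma integralT_exp_1Dcos (e w : R) : 0 < e ->
  (\int[leb]_x (expR (- (e * `|x|)) * (1 + cos (w * x)))%:E
   = (2 * (e^-1 + e / (e ^+ 2 + w ^+ 2)))%:E)%E.
Proof.
move=> e0; rewrite ge0_symfun_integralT.
- rewrite (_ : [set x | _] = `[0, +oo[%classic); last first.
    by apply/seteqP; split => x/=; rewrite in_itv/= andbT.
  rewrite EFinM -(integral_exp_1Dcos w e0); congr (_ * _)%E.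
  by apply: eq_integral => x; rewrite inE/= in_itv/= andbT => x0; rewrite ger0_norm.
- by move=> x; rewrite mulr_ge0 ?expR_ge0// -lerBlDl sub0r cos_geN1.
- by cont.
- by move=> x /=; rewrite normrN mulrN cosN.
Qed.

Lemma L1_exp_1Dcos (e w : R) : 0 < e ->
  L1 (fun x => expR (- (e * `|x|)) * (1 + cos (w * x))).
Proof.
move=> e0.
have m : measurable_fun setT (fun x : R => expR (- (e * `|x|)) * (1 + cos (w * x))).
  by apply: continuous_measurable_fun; cont.
apply/integrableP; split; first exact/measurable_EFinP.
under eq_integral => x _ do rewrite /= ger0_norm ?mulr_ge0 ?expR_ge0 -?lerBlDl ?sub0r ?cos_geN1//.
by rewrite integralT_exp_1Dcos// ltry.
Qed.

Lemma L1_expNMabs (e : R) : 0 < e -> L1 (fun x => expR (- (e * `|x|))).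
Proof.
move=> e0; apply: (le_L1 measurableT _ (L1_exp_1Dcos 0 e0)).
  by apply: continuous_measurable_fun; exact: continuous_expNMabs.
move=> x _; rewrite mul0r cos0 ger0_norm ?expR_ge0// ler_peMr ?expR_ge0//.
by rewrite lerDl.
Qed.

(** The case w = 0 of [integralT_exp_1Dcos] is twice the integral of the bare exponential;
    subtracting that integral removes the summand 1 from the case of general w. *)
Lemma Rintegral_exp_cos (e w : R) : 0 < e ->
  \int[leb]_x (expR (- (e * `|x|)) * cos (w * x)) = 2 * (e / (e ^+ 2 + w ^+ 2)).
Proof.
move=> e0.
have h : \int[leb]_x expR (- (e * `|x|)) = 2 / e.
  have := integralT_exp_1Dcos 0 e0.
  under eq_integral => x _ do rewrite mul0r cos0 mulrC EFinM.
  rewrite integralZl//; last exact: L1_expNMabs.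
  move=> /(congr1 fine); rewrite fineM//; last first.
    by apply: (integrable_fin_num measurableT); exact: L1_expNMabs.
  rewrite /Rintegral /=; set I := fine _ => hI.
  have : (1 + 1) * I = (1 + 1) * (2 / e).
    by rewrite hI; field; rewrite gt_eqF.
  by apply: mulfI; rewrite gt_eqF// addr_gt0.
have ic : L1 (fun x => expR (- (e * `|x|)) * cos (w * x)).
  apply: (le_L1 measurableT _ (L1_expNMabs e0)).
    by apply: continuous_measurable_fun; cont.
  move=> x _; rewrite normrM ger0_norm ?expR_ge0// ler_piMr ?expR_ge0//.
  exact: cos_max.
have := integralT_exp_1Dcos w e0.
move=> /(congr1 fine) /=; rewrite -/(Rintegral _ _ _).
under eq_Rintegral => x _ do rewrite mulrDr mulr1.
rewrite RintegralD//; last exact: L1_expNMabs.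
by rewrite h mulrDr => /addrI.
Qed.

(** Used in two roles: as the rescaled Poisson kernel, whose mass pi enters the inversion formula,
    and as the majorant for transforms with quadratic decay. *)
Lemma L1_oneDsqrV : L1 (fun x => (1 + x ^+ 2)^-1) /\
  \int[leb]_x (1 + x ^+ 2)^-1 = pi.
Proof.
have E : (\int[leb]_x ((1 + x ^+ 2)^-1)%:E = (pi : R)%:E)%E.
  rewrite ge0_symfun_integralT.
  - rewrite (_ : [set x | _] = `[0, +oo[%classic); last first.
      by apply/seteqP; split => x/=; rewrite in_itv/= andbT.
    by rewrite integral0y_oneDsqr -EFinM mulrC divfK.
  - by move=> x; rewrite invr_ge0 addr_ge0// sqr_ge0.
  - exact: continuous_oneDsqrV.
  - by move=> x /=; rewrite sqrrN.
split; last by rewrite /Rintegral E.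
apply/integrableP; split.
  by apply/measurable_EFinP; apply: continuous_measurable_fun; exact: continuous_oneDsqrV.
under eq_integral => x _ do rewrite /= ger0_norm ?invr_ge0 ?addr_ge0 ?sqr_ge0//.
by rewrite E ltry.
Qed.

Lemma L1_exp_bound (f : R -> R) (m K : R) : 0 < m -> measurable_fun setT f ->
  (forall x, `|f x| <= K * expR (- (m * `|x|))) -> L1 f.
Proof.
move=> m0 mf fK.
apply: (@le_L1 _ _ _ (fun x => K * expR (- (m * `|x|)))) => //.
exact: (integrableZl measurableT K (L1_expNMabs m0)).
Qed.

End ExpIntegrals.

(** * Fourier inversion *)

Section FourierInversion.
Variable R : realType.
Local Notation leb := (@lebesgue_measure R).
Local Notation L1 f := (leb.-integrable setT (EFin \o f)).

(** [fcos f] and [fsin f] are the real and imaginary parts of the Fourier transform of f with kernel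
    exp(i t u). *)
Definition fcos (f : R -> R) (t : R) : R := \int[leb]_u (f u * cos (t * u)).
Definition fsin (f : R -> R) (t : R) : R := \int[leb]_u (f u * sin (t * u)).

Lemma L1_fcos (f : R -> R) (t : R) : L1 f -> L1 (fun u => f u * cos (t * u)).
Proof.
move=> if1; have mf : measurable_fun setT f by move/measurable_int/measurable_EFinP : if1.
apply: (le_L1 measurableT _ (integrable_norm if1)).
  by apply: measurable_funM => //; apply: continuous_measurable_fun; cont.
by move=> x _; rewrite normrM ler_piMr// cos_max.
Qed.

Lemma L1_fsin (f : R -> R) (t : R) : L1 f -> L1 (fun u => f u * sin (t * u)).
Proof.
move=> if1; have mf : measurable_fun setT f by move/measurable_int/measurable_EFinP : if1.
apply: (le_L1 measurableT _ (integrable_norm if1)).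
  by apply: measurable_funM => //; apply: continuous_measurable_fun; cont.
by move=> x _; rewrite normrM ler_piMr// sin_max.
Qed.

(** Dominated convergence with majorant |f|. Continuity supplies the measurability of the transforms
    when they are integrated in turn. *)
Lemma continuous_fcos (f : R -> R) : L1 f -> continuous (fcos f).
Proof.
move=> if1; have mf : measurable_fun setT f by move/measurable_int/measurable_EFinP : if1.
move=> t; apply/(@cvg_nbhsP _ R^o) => w wt.
apply: (dominated_cvg_Rintegral measurableT _ _ (integrable_norm if1)).
- by move=> n; apply: measurable_funM => //; apply: continuous_measurable_fun; cont.
- move=> u _; apply: cvgMr.
  have ch : continuous (fun s : R => cos (s * u)) by cont.
  apply: (@cvg_comp _ _ _ w (fun s : R => cos (s * u)) _ (nbhs (t : R))); [exact: wt|exact: ch].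
- by move=> n u _; rewrite normrM ler_piMr// cos_max.
Qed.

Lemma continuous_fsin (f : R -> R) : L1 f -> continuous (fsin f).
Proof.
move=> if1; have mf : measurable_fun setT f by move/measurable_int/measurable_EFinP : if1.
move=> t; apply/(@cvg_nbhsP _ R^o) => w wt.
apply: (dominated_cvg_Rintegral measurableT _ _ (integrable_norm if1)).
- by move=> n; apply: measurable_funM => //; apply: continuous_measurable_fun; cont.
- move=> u _; apply: cvgMr.
  have ch : continuous (fun s : R => sin (s * u)) by cont.
  apply: (@cvg_comp _ _ _ w (fun s : R => sin (s * u)) _ (nbhs (t : R))); [exact: wt|exact: ch].
- by move=> n u _; rewrite normrM ler_piMr// sin_max.
Qed.

(** The left side is the real part of the transform times exp(- i t w), that is, of the transform of
    f translated by w. *)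
Lemma fcos_fsin_shift (f : R -> R) (t w : R) : L1 f ->
  fcos f t * cos (t * w) + fsin f t * sin (t * w)
  = \int[leb]_u (f u * cos (t * (u - w))).
Proof.
move=> if1; rewrite -RintegralZr//; last exact: L1_fcos.
rewrite -RintegralZr//; last exact: L1_fsin.
rewrite -RintegralD//; first last.
- exact: (integrableZr measurableT _ (L1_fsin _ if1)).
- exact: (integrableZr measurableT _ (L1_fcos _ if1)).
apply: eq_Rintegral => u _; rewrite mulrBr cosB; ring.
Qed.

(* Abel summation: against the weight exp(- e |t|) the inversion integral is the
   convolution of f with the Poisson kernel 2 e / (e ^ 2 + u ^ 2). *)
Lemma abel_inversion (f : R -> R) (e w : R) : 0 < e -> continuous f -> L1 f ->
  \int[leb]_t (expR (- (e * `|t|))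
      * (fcos f t * cos (t * w) + fsin f t * sin (t * w)))
  = 2 * \int[leb]_v (f (w + e * v) * (1 + v ^+ 2)^-1).
Proof.
move=> e0 cf if1.
have mf : measurable_fun setT f by move/measurable_int/measurable_EFinP : if1.
pose F (p : R * R) := expR (- (e * `|p.1|)) * (f p.2 * cos (p.1 * (p.2 - w))).
transitivity (\int[leb]_t \int[leb]_u F (t, u)).
  apply: eq_Rintegral => t _; rewrite fcos_fsin_shift// -RintegralZl//.
  have h : continuous (fun u => f u * cos (t * (u - w))) by cont.
  apply: (le_L1 measurableT _ (integrable_norm if1)).
    exact: continuous_measurable_fun.
  by move=> u _; rewrite normrM ler_piMr// cos_max.
(* The weight is what makes the double integral absolutely convergent; without it the integrand has
   no decay in t. *)
rewrite (@Fubini_Rintegral _ F (fun t => expR (- (e * `|t|))) (fun u => `|f u|)).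
- transitivity (\int[leb]_u (2 * (f u * (e / (e ^+ 2 + (u - w) ^+ 2))))).
    apply: eq_Rintegral => u _.
    rewrite mulrCA -Rintegral_exp_cos// -RintegralZl//.
      by apply: eq_Rintegral => t _; rewrite /F/= [(u - w) * t]mulrC; ring.
    apply: (le_L1 measurableT _ (L1_expNMabs e0)).
      by apply: continuous_measurable_fun; cont.
    move=> t _; rewrite normrM ger0_norm ?expR_ge0// ler_piMr ?expR_ge0//.
    exact: cos_max.
  have nz (u : R) : e ^+ 2 + (u - w) ^+ 2 != 0.
    by rewrite gt_eqF// ltr_pwDl ?sqr_ge0// exprn_gt0.
  rewrite RintegralZl//; last first.
    have ch : continuous (fun u => e / (e ^+ 2 + (u - w) ^+ 2)).
      move=> u; apply: cont_mul; first exact: cvg_cst.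
      by apply: cont_inv => //; cont.
    apply: (@le_L1 _ _ _ (fun u => e^-1 * `|f u|)) => //.
    - by apply: measurable_funM => //; exact: continuous_measurable_fun.
    - exact: (integrableZl measurableT _ (integrable_norm if1)).
    - move=> u _; rewrite normrM mulrC ler_wpM2r// ger0_norm; last first.
        by rewrite divr_ge0 ?(ltW e0)// addr_ge0 ?sqr_ge0.
      rewrite ler_pdivrMr ?ltr_pwDl ?exprn_gt0 ?sqr_ge0//.
      by rewrite mulrDr expr2 mulKf ?gt_eqF// lerDl mulr_ge0 ?sqr_ge0 ?invr_ge0 ?ltW.
  congr (2 * _); rewrite /Rintegral; congr fine.
  (* With u = w + e v the kernel e / (e^2 + (u - w)^2) du becomes dv / (1 + v^2), and e survives
     only in the argument of f. *)
  rewrite (@integral_affine _ _ w e)//; last first.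
    move=> u; apply: cont_mul; first exact: cf.
    apply: cont_mul; first exact: cvg_cst.
    by apply: cont_inv => //; cont.
  apply: eq_integral => v _; congr (_%:E).
  have v0 : 1 + v ^+ 2 != 0 by rewrite gt_eqF// ltr_pwDl ?sqr_ge0.
  have := nz (w + e * v).
  rewrite addrAC subrr add0r => ne; field.
  by apply/andP.
- apply: measurable_funM.
    apply: (@measurableT_comp _ _ _ _ _ _ (fun t : R => expR (- (e * `|t|)))).
      by apply: continuous_measurable_fun; cont.
    exact: measurable_fst.
  apply: measurable_funM; first exact: measurableT_comp.
  apply: (@measurableT_comp _ _ _ _ _ _ (@cos R)).
    by apply: continuous_measurable_fun; exact: continuous_cos.
  apply: measurable_funM; first exact: measurable_fst.
  by apply: measurable_funB => //; exact: measurable_snd.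
- exact: L1_expNMabs.
- exact: integrable_norm.
- move=> t u; rewrite /F/= normrM ger0_norm ?expR_ge0// ler_wpM2l ?expR_ge0//.
  by rewrite normrM ler_piMr// cos_max.
Qed.

(** Let e tend to 0 in [abel_inversion]. The left side converges by the decay of the transforms, the
    right side by the boundedness and continuity of f, leaving f w times the mass of the Cauchy
    kernel. *)
Lemma Fourier_inversion (f : R -> R) (B C w : R) : continuous f -> L1 f ->
  (forall u, `|f u| <= B) ->
  (forall t, `|fcos f t| <= C * (1 + t ^+ 2)^-1) ->
  (forall t, `|fsin f t| <= C * (1 + t ^+ 2)^-1) ->
  \int[leb]_t (fcos f t * cos (t * w) + fsin f t * sin (t * w)) = 2 * pi * f w.
Proof.
move=> cf if1 fB fcC fsC.
have [iP PE] := L1_oneDsqrV R.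
have cfc := continuous_fcos if1; have cfs := continuous_fsin if1.
pose e n : R := n.+1%:R^-1.
have e0 n : 0 < e n by rewrite invr_gt0.
have ce : e n @[n --> \oo] --> (0 : R) by exact: cvg_harmonic.
have mP : measurable_fun setT (fun v : R => (1 + v ^+ 2)^-1).
  by move/measurable_int/measurable_EFinP : iP.
have h1 : (fun n => \int[leb]_t (expR (- (e n * `|t|))
      * (fcos f t * cos (t * w) + fsin f t * sin (t * w)))) n @[n --> \oo] -->
    \int[leb]_t (fcos f t * cos (t * w) + fsin f t * sin (t * w)).
  apply: (@dominated_cvg_Rintegral _ _ _ _ (fun t => 2 * C * (1 + t ^+ 2)^-1)) => //.
  - by move=> n; apply: continuous_measurable_fun; cont.
  - move=> t _; set G := (X in _ --> X); rewrite -[G]mul1r; apply: cvgMl.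
    rewrite -[X in _ --> X]expR0.
    apply: continuous_cvg; first exact: continuous_expR.
    rewrite -oppr0; apply: cvgN; rewrite -(mul0r `|t|); apply: cvgMl; exact: ce.
  - exact: (integrableZl measurableT _ iP).
  - move=> n t _; rewrite normrM ger0_norm ?expR_ge0//.
    apply: (@le_trans _ _ `|fcos f t * cos (t * w) + fsin f t * sin (t * w)|).
      by rewrite ler_piMl// -expR0 ler_expR oppr_le0 mulr_ge0// (ltW (e0 n)).
    rewrite (le_trans (ler_normD _ _))// -mulrA mulr_natl mulr2n lerD//.
      by rewrite normrM (le_trans _ (fcC t))// ler_piMr// cos_max.
    by rewrite normrM (le_trans _ (fsC t))// ler_piMr// sin_max.
have h2 : (fun n => \int[leb]_v (f (w + e n * v) * (1 + v ^+ 2)^-1)) n @[n --> \oo] -->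
    \int[leb]_v (f w * (1 + v ^+ 2)^-1).
  apply: (@dominated_cvg_Rintegral _ _ _ _ (fun t => B * (1 + t ^+ 2)^-1)) => //.
  - move=> n; apply: measurable_funM => //.
    by apply: continuous_measurable_fun; cont.
  - move=> v _; apply: cvgMl; apply: continuous_cvg; first exact: cf.
    rewrite -[X in _ --> X]addr0; apply: cvgD; first exact: cvg_cst.
    by rewrite -(mul0r v); apply: cvgMl; exact: ce.
  - exact: (integrableZl measurableT _ iP).
  - move=> n v _; rewrite normrM [X in _ * X]ger0_norm; last first.
      by rewrite invr_ge0 addr_ge0 ?sqr_ge0.
    by rewrite ler_wpM2r// invr_ge0 addr_ge0 ?sqr_ge0.
have E : (fun n => \int[leb]_t (expR (- (e n * `|t|))
      * (fcos f t * cos (t * w) + fsin f t * sin (t * w))))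
    = (fun n => 2 * \int[leb]_v (f (w + e n * v) * (1 + v ^+ 2)^-1)).
  by apply/funext => n; rewrite abel_inversion.
rewrite E in h1.
rewrite RintegralZl// PE in h2.
rewrite -mulrA [pi * _]mulrC.
apply: (cvg_unique _ h1); first exact: Rhausdorff.
by apply: cvgMr; exact: h2.
Qed.

End FourierInversion.

(** * The Gamma function on a vertical line *)

Section LogGamma.
Variable R : realType.
Local Notation leb := (@lebesgue_measure R).
Local Notation L1 f := (leb.-integrable setT (EFin \o f)).
Implicit Types (c t u v : R).

(* The integrand of Euler's integral after the substitution t = exp u. *)
Definition phi c u : R := expR (c * u - expR u).

Lemma continuous_phi c : continuous (phi c).
Proof. by rewrite /phi; cont. Qed.

Lemma expR_ge_sqr4 u : 0 <= u -> u ^+ 2 / 4 <= expR u.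
Proof.
move=> u0; have h : 1 + u / 2 <= expR (u / 2) by exact: expR_ge1Dx.
have e : expR u = expR (u / 2) ^+ 2 by rewrite expr2 -expRD -splitr.
rewrite e; nra.
Qed.

Lemma phi_le c : 0 < c -> exists2 K, 0 <= K &
  forall u, phi c u <= K * expR (- (Num.min c 1 * `|u|)).
Proof.
(* For u >= 0 the exponent c u - exp u + u is at most (c + 1) u - u^2 / 4, whose maximum is (c +
   1)^2. For u < 0 the term c u alone gives decay at rate c. *)
move=> c0; exists (expR ((c + 1) ^+ 2)); first exact: expR_ge0.
move=> u; rewrite /phi -expRD ler_expR.
have m1 : Num.min c 1 <= 1 by rewrite ge_min lexx orbT.
have mc : Num.min c 1 <= c by rewrite ge_min lexx.
have [u0|u0] := leP 0 u.
  rewrite ger0_norm//; have h1 : Num.min c 1 * u <= u by rewrite ler_piMl.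
  have := expR_ge_sqr4 u0; have := sqr_ge0 (c + 1 - u / 2); lra.
rewrite ltr0_norm//.
have h1 : Num.min c 1 * - u <= c * - u by rewrite ler_wpM2r// oppr_ge0 ltW.
have := expR_ge0 u; have := sqr_ge0 (c + 1); lra.
Qed.

Lemma L1_phi c : 0 < c -> L1 (phi c).
Proof.
move=> c0; have [K K0 h] := phi_le c0.
apply: (@L1_exp_bound _ _ (Num.min c 1) K).
- by rewrite lt_min c0 ltr01.
- by apply: continuous_measurable_fun; exact: continuous_phi.
- by move=> u; rewrite ger0_norm ?expR_ge0.
Qed.

Lemma phi_bounded c : 0 < c -> exists B, forall u, `|phi c u| <= B.
Proof.
move=> c0; have [K K0 h] := phi_le c0; exists K => u.
rewrite ger0_norm ?expR_ge0// (le_trans (h u))// ler_piMr// -[X in _ <= X]expR0 ler_expR.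
by rewrite oppr_le0 mulr_ge0// le_min (ltW c0) ler01.
Qed.

Lemma phiS c u : expR u * phi c u = phi (c + 1) u.
Proof. by rewrite /phi -expRD; congr expR; ring. Qed.

Lemma is_derive_phi c u : is_derive u 1 (phi c) (c * phi c u - phi (c + 1) u).
Proof.
by rewrite -phiS /phi; apply: is_derive_eq; rewrite /GRing.scale/=; ring.
Qed.

(** The form in which integration by parts is used below: F is the product whose boundary terms
    vanish. The index [n.+1] keeps the intervals of the fundamental theorem nondegenerate. *)
Lemma Rintegral_derive0 (F f : R -> R) : (forall x : R, is_derive x 1 F (f x)) ->
  continuous f -> L1 f ->
  F n.+1%:R @[n --> \oo] --> (0 : R) -> F (- n.+1%:R) @[n --> \oo] --> (0 : R) ->
  \int[leb]_x f x = 0.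
Proof.
move=> dF cf if1 F1 F2.
pose D (n : nat) := `[- n.+1%:R, n.+1%:R : R]%classic.
have mD n : measurable (D n) by exact: measurable_itv.
have mf : measurable_fun setT f by exact: continuous_measurable_fun.
have cF (x : R) : {for x, continuous F}.
  by apply/differentiable_continuous/derivable1_diffP; case: (dF x).
have h1 : (fun n => \int[leb]_(x in D n) f x) n @[n --> \oo] --> \int[leb]_x f x.
  under eq_fun do rewrite Rintegral_mkcond.
  apply: (dominated_cvg_Rintegral measurableT _ _ (integrable_norm if1)).
  - by move=> n; apply/(measurable_restrictT _ (mD n)); exact: measurable_funTS.
  - move=> x _; apply: cvg_near_cst; near=> n.
    rewrite patchE ifT// inE /D/= in_itv/= -ler_norml.
    by apply: (@le_trans _ _ n%:R); [near: n; exact: nbhs_infty_ger|rewrite ler_nat].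
  - by move=> n x _; rewrite /= patchE; case: ifP => // _; rewrite normr0.
have E : (fun n => \int[leb]_(x in D n) f x) = (fun n => F n.+1%:R - F (- n.+1%:R)).
  apply/funext => n; rewrite /Rintegral (@continuous_FTC2 _ f F)//.
  - by rewrite (@lt_trans _ _ 0)// oppr_lt0.
  - exact: continuous_subspaceT.
  - split.
    + by move=> x _; case: (dF x).
    + by apply: cvg_at_right_filter; exact: cF.
    + by apply: cvg_at_left_filter; exact: cF.
  - by move=> x _; rewrite derive1E derive_val.
rewrite E in h1.
apply: (cvg_unique _ h1); first exact: Rhausdorff.
by rewrite -(subrr (0 : R)); apply: cvgB.
Unshelve. all: by end_near.
Qed.

Lemma phi_mul_cvg0 c (g : R -> R) : 0 < c -> (forall x, `|g x| <= 1) ->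
  phi c n.+1%:R * g n.+1%:R @[n --> \oo] --> (0 : R) /\
  phi c (- n.+1%:R) * g (- n.+1%:R) @[n --> \oo] --> (0 : R).
Proof.
move=> c0 g1; have [K K0 h] := phi_le c0.
set m := Num.min c 1 in h.
have m0 : 0 < m by rewrite lt_min c0 ltr01.
have h0 : (fun n : nat => expR (- (m * n.+1%:R)) * K) n @[n --> \oo] --> (0 : R).
  have /cvg_mul_expRN : forall x : R, `|cst K x| <= K by move=> x; rewrite ger0_norm.
  move=> /(_ _ m0) /cvg_pinftyP; apply.
  apply/cvgryPge => A; near=> n; apply: (@le_trans _ _ n%:R); last by rewrite ler_nat.
  by near: n; exact: nbhs_infty_ger.
split; apply/norm_cvg0P; apply: (squeeze_cvgr _ (cvg_cst (0 : R)) h0).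
- near=> n => /=; rewrite normr_ge0/= normrM (ger0_norm (expR_ge0 _)).
  rewrite (le_trans (ler_piMr _ (g1 _))) ?expR_ge0//.
  by rewrite (le_trans (h _))// mulrC ger0_norm.
- near=> n => /=; rewrite normr_ge0/= normrM (ger0_norm (expR_ge0 _)).
  rewrite (le_trans (ler_piMr _ (g1 _))) ?expR_ge0//.
  by rewrite (le_trans (h _))// mulrC normrN ger0_norm.
Unshelve. all: by end_near.
Qed.

(* These two lemmas are the functional equation Gamma (s + 1) = s Gamma s. *)
Lemma fsin_phi c t : 0 < c ->
  t * fsin (phi c) t = c * fcos (phi c) t - fcos (phi (c + 1)) t.
Proof.
move=> c0; have c10 : 0 < c + 1 by rewrite addr_gt0.
have i1 := L1_fcos t (L1_phi c0); have i2 := L1_fsin t (L1_phi c0).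
have i3 := L1_fcos t (L1_phi c10).
have [p1 p2] := phi_mul_cvg0 (g := fun u => cos (t * u)) c0 (fun x => cos_max (t * x)).
have cp := @continuous_phi c; have cp1 := @continuous_phi (c + 1).
(* The derivative of [phi c u * cos (t * u)]; its three terms are those of the identity to be
   proved. *)
pose f u := c * (phi c u * cos (t * u)) - phi (c + 1) u * cos (t * u)
            - t * (phi c u * sin (t * u)).
have j1 := integrableZl measurableT c i1.
have j2 := integrableZl measurableT t i2.
have j12 := integrableB measurableT j1 i3.
suff : \int[leb]_u f u = 0.
  rewrite /f RintegralB// RintegralB// RintegralZl// RintegralZl//.
  by move/eqP; rewrite subr_eq0 => /eqP.
apply: (@Rintegral_derive0 (fun u => phi c u * cos (t * u)) f) => //.
- move=> x; have dp := is_derive_phi c x.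
  rewrite /f; apply: is_derive_eq; rewrite /GRing.scale/=; ring.
- by rewrite /f; cont.
- exact: (integrableB measurableT j12 j2).
Qed.

Lemma fcos_phi c t : 0 < c ->
  t * fcos (phi c) t = fsin (phi (c + 1)) t - c * fsin (phi c) t.
Proof.
move=> c0; have c10 : 0 < c + 1 by rewrite addr_gt0.
have i1 := L1_fsin t (L1_phi c0); have i2 := L1_fcos t (L1_phi c0).
have i3 := L1_fsin t (L1_phi c10).
have [p1 p2] := phi_mul_cvg0 (g := fun u => sin (t * u)) c0 (fun x => sin_max (t * x)).
have cp := @continuous_phi c; have cp1 := @continuous_phi (c + 1).
pose f u := c * (phi c u * sin (t * u)) - phi (c + 1) u * sin (t * u)
            + t * (phi c u * cos (t * u)).
have j1 := integrableZl measurableT c i1.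
have j2 := integrableZl measurableT t i2.
have j12 := integrableB measurableT j1 i3.
suff : \int[leb]_u f u = 0.
  rewrite /f RintegralD// RintegralB// RintegralZl// RintegralZl//.
  rewrite -/(fsin _ _) -/(fsin _ _) -/(fcos _ _) => h.
  by apply/eqP; rewrite -subr_eq0 -[X in _ == X]h; apply/eqP; ring.
apply: (@Rintegral_derive0 (fun u => phi c u * sin (t * u)) f) => //.
- move=> x; have dp := is_derive_phi c x.
  rewrite /f; apply: is_derive_eq; rewrite /GRing.scale/=; ring.
- by rewrite /f; cont.
- exact: (integrableD measurableT j12 j2).
Qed.

Lemma fourier_phi_bounded c : 0 < c -> exists N,
  forall t, `|fcos (phi c) t| <= N /\ `|fsin (phi c) t| <= N.
Proof.
move=> c0; exists (\int[leb]_u `|phi c u|) => t; split.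
- apply: (le_trans (le_normr_Rintegral measurableT (L1_fcos t (L1_phi c0)))).
  apply: le_Rintegral => //.
  + exact: integrable_norm (L1_fcos t (L1_phi c0)).
  + exact: integrable_norm (L1_phi c0).
  + by move=> u _; rewrite normrM ler_piMr// cos_max.
- apply: (le_trans (le_normr_Rintegral measurableT (L1_fsin t (L1_phi c0)))).
  apply: le_Rintegral => //.
  + exact: integrable_norm (L1_fsin t (L1_phi c0)).
  + exact: integrable_norm (L1_phi c0).
  + by move=> u _; rewrite normrM ler_piMr// sin_max.
Qed.

(** Two rounds of the functional equation express t^2 times a transform of [phi c] through
    transforms of [phi c], [phi (c + 1)] and [phi (c + 1 + 1)], each bounded by an L1 norm. *)
Lemma fourier_phi_decay c : 0 < c -> exists C,
  forall t, `|fcos (phi c) t| <= C * (1 + t ^+ 2)^-1 /\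
            `|fsin (phi c) t| <= C * (1 + t ^+ 2)^-1.
Proof.
move=> c0; have c10 : 0 < c + 1 by rewrite addr_gt0.
have c20 : 0 < c + 1 + 1 by rewrite addr_gt0.
have [N0 h0] := fourier_phi_bounded c0.
have [N1 h1] := fourier_phi_bounded c10.
have [N2 h2] := fourier_phi_bounded c20.
(* N0 pays for the summand 1 of 1 + t^2; the bracket follows the four terms of [EA] and [ES]. *)
exists (N0 + (c ^+ 2 * N0 + c * N1 + (c + 1) * N1 + N2)) => t.
have d0 : 0 < 1 + t ^+ 2 by rewrite ltr_pwDl// sqr_ge0.
have [a0 b0] := h0 t; have [a1 b1] := h1 t; have [a2 b2] := h2 t.
have S0 := fsin_phi t c0; have A0 := fcos_phi t c0.
have S1 := fsin_phi t c10; have A1 := fcos_phi t c10.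
have EA : t ^+ 2 * fcos (phi c) t = - c ^+ 2 * fcos (phi c) t + c * fcos (phi (c + 1)) t
    + (c + 1) * fcos (phi (c + 1)) t - fcos (phi (c + 1 + 1)) t.
  by rewrite expr2 -mulrA A0 mulrBr mulrCA S0 S1; ring.
have ES : t ^+ 2 * fsin (phi c) t = - c ^+ 2 * fsin (phi c) t + c * fsin (phi (c + 1)) t
    + (c + 1) * fsin (phi (c + 1)) t - fsin (phi (c + 1 + 1)) t.
  by rewrite expr2 -mulrA S0 mulrBr mulrCA A0 A1; ring.
split; rewrite ler_pdivlMr// -(ger0_norm (ltW d0)) -normrM mulrC mulrDl mul1r.
- rewrite EA (le_trans (ler_normD _ _))// lerD//.
  rewrite (le_trans (ler_normB _ _))// lerD//.
  rewrite (le_trans (ler_normD _ _))// lerD//; last first.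
    by rewrite normrM (gtr0_norm c10) ler_pM2l.
  rewrite (le_trans (ler_normD _ _))// lerD//; last first.
    by rewrite normrM (gtr0_norm c0) ler_pM2l.
  by rewrite normrM normrN normrX (gtr0_norm c0) ler_pM2l ?exprn_gt0.
- rewrite ES (le_trans (ler_normD _ _))// lerD//.
  rewrite (le_trans (ler_normB _ _))// lerD//.
  rewrite (le_trans (ler_normD _ _))// lerD//; last first.
    by rewrite normrM (gtr0_norm c10) ler_pM2l.
  rewrite (le_trans (ler_normD _ _))// lerD//; last first.
    by rewrite normrM (gtr0_norm c0) ler_pM2l.
  by rewrite normrM normrN normrX (gtr0_norm c0) ler_pM2l ?exprn_gt0.
Qed.

(** In Euler's integral with x = exp u, the measure exp u du absorbs the -1 of x^(s - 1), and x^(i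
    t) becomes exp(i t u). *)
Lemma CGammaE (a t : R) :
  CGamma (a +i* t) = fcos (phi a) t +i* fsin (phi a) t.
Proof.
(* One substitution with an arbitrary factor [h (ln x)] serves both the cosine and the sine part. *)
have H (h : R -> R) : continuous h ->
    \int[leb]_(x in `]0, +oo[) (expR ((a - 1) * ln x) * h (ln x) * expR (- x))
    = \int[leb]_u (phi a u * h u).
  move=> ch; rewrite /Rintegral integral_expR.
    congr fine; apply: eq_integral => u _; rewrite expRK /phi; congr (_%:E).
    by rewrite -!mulrA [h u * _]mulrC !mulrA -!expRD; congr (expR _ * _); ring.
  move=> x; rewrite in_itv/= andbT => x0.
  have cl : continuous_at x (@ln R) by exact: continuous_ln.
  apply: cont_mul; last by cont.
  have ck : continuous (fun u => expR ((a - 1) * u) * h u) by cont.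
  exact: (@cont_comp _ (@ln R) _ x ck cl).
rewrite /CGamma /Cintegral; congr (_ +i* _).
- rewrite /fcos -(H (fun u => cos (t * u))); last by cont.
  by apply: eq_Rintegral => x _; rewrite /cpow /= subr0; ring.
- rewrite /fsin -(H (fun u => sin (t * u))); last by cont.
  by apply: eq_Rintegral => x _; rewrite /cpow /= subr0; ring.
Qed.

Lemma fcosN (f : R -> R) t : fcos f (- t) = fcos f t.
Proof. by apply: eq_Rintegral => u _; rewrite mulNr cosN. Qed.

Lemma fsinN (f : R -> R) t : L1 f -> fsin f (- t) = - fsin f t.
Proof.
move=> if1; rewrite /fsin -[RHS]mulN1r -RintegralZl//; last exact: L1_fsin.
by apply: eq_Rintegral => u _; rewrite mulNr sinN; ring.
Qed.

(* Parseval; the integrand is the real part of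
   Gamma(a + i t) Gamma(b + i t) exp(- i t v). *)
Lemma Rintegral_fourier_phi_mul (a b v : R) : 0 < a -> 0 < b ->
  \int[leb]_t (fcos (phi b) t * (fcos (phi a) t * cos (t * v) + fsin (phi a) t * sin (t * v))
    + fsin (phi b) t * (fcos (phi a) t * sin (t * v) - fsin (phi a) t * cos (t * v)))
  = 2 * pi * \int[leb]_u (phi b u * phi a (v - u)).
Proof.
move=> a0 b0.
have ia := L1_phi a0; have ib := L1_phi b0.
have ca := continuous_fcos ia; have sa := continuous_fsin ia.
have cb := @continuous_phi b; have cpa := @continuous_phi a.
have [C hC] := fourier_phi_decay a0.
have [B hB] := phi_bounded a0.
have [iP _] := L1_oneDsqrV R.
pose F (p : R * R) := phi b p.2
  * (fcos (phi a) p.1 * cos (p.1 * (v - p.2)) + fsin (phi a) p.1 * sin (p.1 * (v - p.2))).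
have bd t w : `|fcos (phi a) t * cos (t * w) + fsin (phi a) t * sin (t * w)|
    <= 2 * C * (1 + t ^+ 2)^-1.
  have [h1 h2] := hC t.
  rewrite (le_trans (ler_normD _ _))// -mulrA mulr_natl mulr2n lerD//.
    by rewrite normrM (le_trans _ h1)// ler_piMr// cos_max.
  by rewrite normrM (le_trans _ h2)// ler_piMr// sin_max.
have iP2 : L1 (fun t => 2 * C * (1 + t ^+ 2)^-1) by exact: (integrableZl measurableT _ iP).
(* Only the transform of [phi b] is written out as an integral over u. After the exchange the inner
   integral over t is the inversion formula for [phi a] at the point v - u. *)
transitivity (\int[leb]_t \int[leb]_u F (t, u)).
  apply: eq_Rintegral => t _.
  rewrite -[fcos (phi b) t * _]RintegralZr//; last exact: L1_fcos.
  rewrite -[fsin (phi b) t * _]RintegralZr//; last exact: L1_fsin.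
  rewrite -RintegralD//; first last.
  - exact: (integrableZr measurableT _ (L1_fsin _ ib)).
  - exact: (integrableZr measurableT _ (L1_fcos _ ib)).
  by apply: eq_Rintegral => u _; rewrite /F/= [t * (v - u)]mulrBr cosB sinB; ring.
rewrite (@Fubini_Rintegral _ F (fun t => 2 * C * (1 + t ^+ 2)^-1) (phi b))//; first last.
- move=> t u; rewrite /F/= mulrC normrM [`|phi b u|]ger0_norm ?expR_ge0//.
  by rewrite ler_wpM2r ?expR_ge0.
- have m1 : measurable_fun setT (fun p : R * R => p.1 * (v - p.2)).
    apply: measurable_funM; first exact: measurable_fst.
    by apply: measurable_funB => //; exact: measurable_snd.
  have mc (h : R -> R) (g : R * R -> R) : continuous h -> measurable_fun setT g ->
      measurable_fun setT (fun p => h (g p)).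
    by move=> ch; apply: measurableT_comp; exact: continuous_measurable_fun.
  apply: measurable_funM; first by apply: mc => //; exact: measurable_snd.
  apply: measurable_funD; apply: measurable_funM.
  + by apply: mc => //; exact: measurable_fst.
  + by apply: mc => //; exact: continuous_cos.
  + by apply: mc => //; exact: measurable_fst.
  + by apply: mc => //; exact: continuous_sin.
rewrite -RintegralZl//; last first.
  apply: (@le_L1 _ _ _ (fun u => phi b u * B)) => //.
  - by apply: continuous_measurable_fun; cont.
  - exact: (integrableZr measurableT _ ib).
  - by move=> u _; rewrite normrM ger0_norm ?expR_ge0// ler_wpM2l ?expR_ge0.
apply: eq_Rintegral => u _.
rewrite mulrCA -(@Fourier_inversion _ _ B C (v - u))//; first last.
- by move=> t; case: (hC t).
- by move=> t; case: (hC t).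
rewrite -RintegralZl//.
apply: (@le_L1 _ _ _ (fun t => 2 * C * (1 + t ^+ 2)^-1)) => //.
by apply: continuous_measurable_fun; cont.
Qed.

End LogGamma.

(** * The Mellin-Barnes integral *)

Section MellinBarnes.
Variable R : realType.
Local Notation leb := (@lebesgue_measure R).
Local Notation L1 f := (leb.-integrable setT (EFin \o f)).

Lemma continuous_cosh : continuous (@cosh R).
Proof.
have -> : @cosh R = (fun t => (expR t + expR (- t)) * 2^-1) by apply/funext.
by cont.
Qed.

Lemma coshN (t : R) : cosh (- t) = cosh t.
Proof. by rewrite /cosh opprK addrC. Qed.

(** With p = exp(t / 2) and q = 1 / p one has cosh t = 1 + (p - q)^2 / 2, and p - q >= t / 2 for t
    >= 0. The quadratic term later yields a Gaussian majorant that does not depend on the scale. *)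
Lemma cosh_ge (t : R) : 1 + t ^+ 2 / 8 <= cosh t.
Proof.
wlog t0 : t / 0 <= t => [H|].
  have [/H//|/ltW t0] := leP 0 t.
  by rewrite -coshN -sqrrN; apply: H; rewrite oppr_ge0.
have p1 : 1 + t / 2 <= expR (t / 2) by exact: expR_ge1Dx.
have q1 : expR (- (t / 2)) <= 1 by rewrite -expR0 ler_expR oppr_le0 divr_ge0.
have e1 : expR t = expR (t / 2) ^+ 2 by rewrite expr2 -expRD -splitr.
have e2 : expR (- t) = expR (- (t / 2)) ^+ 2 by rewrite expr2 -expRD -opprD -splitr.
have pq : expR (t / 2) * expR (- (t / 2)) = 1 by rewrite expRN divff// gt_eqF// expR_gt0.
rewrite /cosh e1 e2.
move: p1 q1 pq; set p := expR (t / 2); set q := expR (- (t / 2)) => p1 q1 pq.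
have : (t / 2) ^+ 2 <= (p - q) ^+ 2.
  by rewrite ler_pXn2r ?nnegrE ?divr_ge0//; lra.
have -> : (p - q) ^+ 2 = p ^+ 2 + q ^+ 2 - 2 * (p * q) by ring.
rewrite pq; lra.
Qed.

(** The maximum of - a w^2 + (b + 1) w is (b + 1)^2 / (4 a). Trading the Gaussian for exp(- w) makes
    [L1_expNMabs] the only majorant required. *)
Lemma quad_exp_le (a b w : R) : 0 < a -> - (a * w ^+ 2) + b * w <= (b + 1) ^+ 2 / (4 * a) - w.
Proof.
move=> a0; have a40 : 0 < 4 * a by rewrite mulr_gt0.
rewrite -lerBlDr opprK ler_pdivlMr//.
have := sqr_ge0 (2 * a * w - (b + 1)); lra.
Qed.

Lemma expM_cosh_le (b x w : R) : 0 <= b -> 0 < x ->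
  expR (b * `|w| - x * cosh w) <= expR ((b + 1) ^+ 2 / (4 * (x / 8))) * expR (- (1 * `|w|)).
Proof.
move=> b0 x0; rewrite -expRD ler_expR mul1r.
have x8 : 0 < x / 8 by rewrite divr_gt0.
have h := quad_exp_le b `|w| x8; rewrite real_normK ?num_real// in h.
have : x * (1 + w ^+ 2 / 8) <= x * cosh w by rewrite ler_pM2l// cosh_ge.
lra.
Qed.

Lemma L1_expM_cosh (b x : R) : 0 < x -> L1 (fun w => expR (b * w - x * cosh w)).
Proof.
move=> x0; apply: (@L1_exp_bound _ _ 1 (expR ((`|b| + 1) ^+ 2 / (4 * (x / 8))))) => //.
  by apply: continuous_measurable_fun; have cc := continuous_cosh; cont.
move=> w; rewrite ger0_norm ?expR_ge0// (le_trans _ (expM_cosh_le w (normr_ge0 b) x0))//.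
by rewrite ler_expR lerB// -normrM ler_norm.
Qed.

Lemma L1_besselK (n : nat) (x : R) : 0 < x ->
  L1 (fun w => expR (- (x * cosh w)) * cosh (n%:R * w)).
Proof.
move=> x0.
have i1 := integrableZl measurableT 2^-1 (L1_expM_cosh n%:R x0).
have i2 := integrableZl measurableT 2^-1 (L1_expM_cosh (- n%:R) x0).
apply: eq_integrable (integrableD measurableT i1 i2) => // w _.
rewrite /= -EFinM -EFinM -EFinD; congr (_%:E).
rewrite {4}/cosh !expRD mulNr; ring.
Qed.

(** The even part of exp(n w) is cosh(n w), and the line counts the half-line twice. A single
    exponential in the integrand is the form that a substitution can match. *)
Lemma Rintegral_expM_cosh (n : nat) (x : R) : 0 < x ->
  \int[leb]_w expR (n%:R * w - x * cosh w) = 2 * besselK n x.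
Proof.
move=> x0.
have cc := continuous_cosh.
have ce (b : R) : continuous (fun w => expR (b * w - x * cosh w)) by cont.
have refl : \int[leb]_w expR (- n%:R * w - x * cosh w) = \int[leb]_w expR (n%:R * w - x * cosh w).
  apply: (congr1 fine); apply: etrans (integral_reflect (ce (- n%:R))) _.
  by apply: eq_integral => w _; rewrite coshN mulrNN.
have iK := L1_besselK n x0.
have E : (\int[leb]_w (expR (- (x * cosh w)) * cosh (n%:R * w))%:E)%E
    = (\int[leb]_w expR (n%:R * w - x * cosh w))%:E.
  rewrite -[LHS]fineK; last exact: (integrable_fin_num measurableT iK).
  congr EFin.
  transitivity (\int[leb]_w (2^-1 * expR (n%:R * w - x * cosh w)
      + 2^-1 * expR (- n%:R * w - x * cosh w))).
    apply: eq_Rintegral => w _; rewrite {2}/cosh !expRD mulNr; ring.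
  have i1 := L1_expM_cosh n%:R x0; have i2 := L1_expM_cosh (- n%:R) x0.
  rewrite RintegralD//; first last.
  - exact: (integrableZl measurableT _ i2).
  - exact: (integrableZl measurableT _ i1).
  rewrite !RintegralZl// refl; set X := Rintegral _ _ _.
  by field.
move: E; rewrite ge0_symfun_integralT.
- rewrite (_ : [set x | _] = `[0, +oo[%classic); last first.
    by apply/seteqP; split => y/=; rewrite in_itv/= andbT.
  move=> /(congr1 fine) /= <-; rewrite fineM//.
  apply: (@integrable_fin_num _ _ _ leb `[0, +oo[%classic (measurable_itv _)).
  exact: integrableS iK.
- by move=> w; rewrite mulr_ge0 ?expR_ge0// (le_trans _ (cosh_ge _))// addr_ge0// divr_ge0// sqr_ge0.
- by cont.
- by move=> w /=; rewrite mulrN !coshN.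
Qed.

(** Centring at u = ln y / 2 + w turns the two double exponentials into sqrt y exp w and sqrt y
    exp(- w), whose sum is 2 sqrt y cosh w; the linear exponents leave n w and the constant
    factors. *)
Lemma phi_conv (n : nat) (c y : R) : 0 < c -> 0 < y ->
  \int[leb]_u (phi (n%:R + c) u * phi c (ln y - u))
  = expR (c * ln y) * (expR (n%:R / 2 * ln y) * (2 * besselK n (2 * Num.sqrt y))).
Proof.
move=> c0 y0; have s0 : 0 < 2 * Num.sqrt y by rewrite mulr_gt0// sqrtr_gt0.
have ey : expR (ln y / 2) = Num.sqrt y.
  apply/esym/(@pexpIrn _ 2) => //; rewrite ?nnegrE ?sqrtr_ge0 ?expR_ge0//.
  by rewrite sqr_sqrtr ?ltW// expr2 -expRD -splitr lnK.
have c1 := @continuous_phi _ (n%:R + c); have c2 := @continuous_phi _ c.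
have i := L1_expM_cosh n%:R s0.
rewrite -Rintegral_expM_cosh// -RintegralZl// -RintegralZl//; last first.
  exact: (integrableZl measurableT _ i).
rewrite /Rintegral (@integral_affine _ _ (ln y / 2) 1)//; last by cont.
congr fine; apply: eq_integral => w _; congr (_%:E).
rewrite mulr1 mul1r /phi -!expRD; congr expR.
have -> : ln y - (ln y / 2 + w) = ln y / 2 - w by rewrite {1}[ln y]splitr; ring.
rewrite [expR (ln y / 2 + w)]expRD [expR (ln y / 2 - w)]expRD ey /cosh.
by rewrite {1}[ln y]splitr; field.
Qed.

Lemma L1_fourier_phi_mul (a b v : R) : 0 < a -> 0 < b ->
  L1 (fun t => fcos (phi b) t * (fcos (phi a) t * cos (t * v) + fsin (phi a) t * sin (t * v))
    + fsin (phi b) t * (fcos (phi a) t * sin (t * v) - fsin (phi a) t * cos (t * v))).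
Proof.
move=> a0 b0; have [C hC] := fourier_phi_decay a0; have [N hN] := fourier_phi_bounded b0.
have ca := continuous_fcos (L1_phi a0); have sa := continuous_fsin (L1_phi a0).
have cb := continuous_fcos (L1_phi b0); have sb := continuous_fsin (L1_phi b0).
have [iP _] := L1_oneDsqrV R.
(* Four products, in each of which a transform of [phi b] is bounded by N and one of [phi a] decays
   with constant C. *)
apply: (le_L1 measurableT _ (integrableZl measurableT (4 * N * C) iP)).
  by apply: continuous_measurable_fun; cont.
move=> t _; have [h1 h2] := hC t; have [h3 h4] := hN t.
have bc (x y : R) : `|x| <= C * (1 + t ^+ 2)^-1 -> `|y| <= 1 -> `|x * y| <= C * (1 + t ^+ 2)^-1.
  by move=> hx hy; rewrite normrM (le_trans _ hx)// ler_piMr.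
have -> : 4 * N * C * (1 + t ^+ 2)^-1 = N * (C * (1 + t ^+ 2)^-1 + C * (1 + t ^+ 2)^-1)
    + N * (C * (1 + t ^+ 2)^-1 + C * (1 + t ^+ 2)^-1) by ring.
rewrite (le_trans (ler_normD _ _))// lerD// normrM ler_pM//.
  by rewrite (le_trans (ler_normD _ _))// lerD// bc ?cos_max ?sin_max.
by rewrite (le_trans (ler_normB _ _))// lerD// bc ?cos_max ?sin_max.
Qed.

(** The real part is the Parseval formula with exponents c and l + c at v = ln y, and its
    convolution is the Bessel function by [phi_conv]. *)
Lemma meijerGE (c y : R) (l : nat) : 0 < c -> 0 < y ->
  meijerG2002 c 0 l%:R y = (2 * (y `^ (l%:R / 2) * besselK l (2 * Num.sqrt y)))%:C.
Proof.
move=> c0 y0; have lc0 : 0 < l%:R + c by rewrite ltr_wpDl.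
have ia := L1_phi c0; have ib := L1_phi lc0.
have ca := continuous_fcos ia; have sa := continuous_fsin ia.
have cb := continuous_fcos ib; have sb := continuous_fsin ib.
pose A := fcos (@phi R c); pose S := fsin (@phi R c).
pose A' := fcos (@phi R (l%:R + c)); pose S' := fsin (@phi R (l%:R + c)).
pose v := ln y.
have Re_ t : complex.Re (CGamma ((0:R)%:C + (c +i* t)) * CGamma ((l%:R:R)%:C + (c +i* t))
      * cpow y (- (c +i* t)))
    = expR (- (c * v)) * (A' t * (A t * cos (t * v) + S t * sin (t * v))
        + S' t * (A t * sin (t * v) - S t * cos (t * v))).
  rewrite (_ : 0%:C + (c +i* t) = c +i* t); last by rewrite add0r.
  rewrite (_ : l%:R%:C + (c +i* t) = (l%:R + c) +i* t); last first.
    by apply/eqP; rewrite eq_complex /= add0r !eqxx.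
  rewrite !CGammaE /cpow /= -/v -/(A t) -/(S t) -/(A' t) -/(S' t) !mulNr cosN sinN.
  by ring.
have Im_ t : complex.Im (CGamma ((0:R)%:C + (c +i* t)) * CGamma ((l%:R:R)%:C + (c +i* t))
      * cpow y (- (c +i* t)))
    = expR (- (c * v)) * ((A' t * S t + S' t * A t) * cos (t * v)
        - (A t * A' t - S t * S' t) * sin (t * v)).
  rewrite (_ : 0%:C + (c +i* t) = c +i* t); last by rewrite add0r.
  rewrite (_ : l%:R%:C + (c +i* t) = (l%:R + c) +i* t); last first.
    by apply/eqP; rewrite eq_complex /= add0r !eqxx.
  rewrite !CGammaE /cpow /= -/v -/(A t) -/(S t) -/(A' t) -/(S' t) !mulNr cosN sinN.
  by ring.
have -> : meijerG2002 c 0 l%:R y = ((2 * pi)^-1)%:C *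
    ((2 * pi * (2 * (y `^ (l%:R / 2) * besselK l (2 * Num.sqrt y)))) +i* 0).
  rewrite /meijerG2002; congr (_ * _); rewrite /Cintegral; congr (_ +i* _).
  - transitivity (\int[leb]_t (expR (- (c * v)) * (A' t * (A t * cos (t * v) + S t * sin (t * v))
        + S' t * (A t * sin (t * v) - S t * cos (t * v))))).
      by apply: eq_Rintegral => t _; exact: Re_.
    rewrite RintegralZl//; last exact: L1_fourier_phi_mul.
    rewrite Rintegral_fourier_phi_mul// phi_conv// -/v.
    have ee : expR (- (c * v)) * expR (c * v) = 1.
      by rewrite expRN mulVf// gt_eqF// expR_gt0.
    rewrite /powR gt_eqF// -/v; set K := besselK _ _; set L := expR (l%:R / 2 * v).
    transitivity (expR (- (c * v)) * expR (c * v) * (2 * pi * (L * (2 * K)))).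
      by ring.
    by rewrite ee mul1r; ring.
  - transitivity (\int[leb]_t (expR (- (c * v)) * ((A' t * S t + S' t * A t) * cos (t * v)
        - (A t * A' t - S t * S' t) * sin (t * v)))).
      by apply: eq_Rintegral => t _; exact: Im_.
    have cA : continuous A := ca; have cS : continuous S := sa.
    have cA' : continuous A' := cb; have cS' : continuous S' := sb.
    have AN t : A (- t) = A t by exact: fcosN.
    have SN t : S (- t) = - S t by exact: fsinN.
    have AN' t : A' (- t) = A' t by exact: fcosN.
    have SN' t : S' (- t) = - S' t by exact: fsinN.
    clear ca sa cb sb ia ib Re_ Im_; clearbody A S A' S'.
    (* [A] and [A'] are even and [S] and [S'] are odd in t, so every term of the imaginary part is
       odd. *)
    apply: Rintegral_odd; first by cont.
    by move=> t; rewrite AN SN AN' SN' !mulNr cosN sinN; ring.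
apply/eqP; rewrite eq_complex /= !mul0r !mulr0 subr0 addr0 eqxx andbT.
by rewrite mulKf// mulf_neq0// gt_eqF// pi_gt0.
Qed.

End MellinBarnes.

(** * Limits of K *)

Section BesselKLimits.
Variable R : realType.
Local Notation leb := (@lebesgue_measure R).
Local Notation L1 f := (leb.-integrable setT (EFin \o f)).

(** From the right the integrand at x is itself the majorant. This side is the relevant one, since
    alpha mu > 1 for 0 < mu < 1. *)
Lemma besselK_cvg_right (n : nat) (x : R) : 0 < x ->
  besselK n t @[t --> x^'+] --> besselK n x.
Proof.
move=> x0; apply/cvg_at_rightP => u [ux uc].
have cc := @continuous_cosh R.
have mD : measurable `[0 : R, +oo[%classic by exact: measurable_itv.
have iK : leb.-integrable `[0, +oo[ (EFin \o (fun w => expR (- (x * cosh w)) * cosh (n%:R * w))).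
  exact: integrableS (L1_besselK n x0).
have cosh0 (w : R) : 0 <= cosh w.
  by rewrite (le_trans _ (cosh_ge _))// addr_ge0// divr_ge0// sqr_ge0.
apply: (dominated_cvg_Rintegral mD _ _ iK).
- by move=> k; apply: measurable_funTS; apply: continuous_measurable_fun; cont.
- move=> w _; apply: cvgMl; apply: continuous_cvg; first exact: continuous_expR.
  by apply: cvgN; apply: cvgMl.
- move=> k w _; rewrite ger0_norm ?mulr_ge0 ?expR_ge0// ler_wpM2r// ler_expR lerN2.
  by rewrite ler_wpM2r// ltW.
Qed.

Lemma cvg_quotient_at_right0 (G : R -> R) (d : R) : is_derive (0 : R) 1 G d -> G 0 = 0 ->
  G r / r @[r --> 0^'+] --> d.
Proof.
move=> [dG Gd] G0; apply: cvg_dnbhs_at_right; rewrite -Gd.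
have h : (fun h : R => h^-1 *: ((G \o shift 0) (h *: 1) - G 0)) x @[x --> 0^'] --> 'D_1 G 0.
  exact: dG.
apply: (cvg_trans _ h); apply: near_eq_cvg; near=> r.
by rewrite /= G0 subr0 addr0 /GRing.scale/= mulr1 mulrC.
Unshelve. all: by end_near.
Qed.

(** The expression is exactly (G r / r)^2 with G r = 2 sinh(r u / 2), and G'(0) = u. *)
Lemma cvg_cosh_gauss (u : R) :
  2 / r ^+ 2 * (cosh (r * u) - 1) @[r --> 0^'+] --> u ^+ 2.
Proof.
pose G (r : R) := expR (r * (u / 2)) - expR (- (r * (u / 2))).
have dG : is_derive (0 : R) 1 G u.
  rewrite /G; apply: is_derive_eq.
  by rewrite /GRing.scale/= mul0r oppr0 expR0; field.
have G0 : G 0 = 0 by rewrite /G mul0r oppr0 subrr.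
have h := cvg_quotient_at_right0 dG G0.
have h2 : (G r / r) * (G r / r) @[r --> 0^'+] --> u * u by exact: (cvgM h h).
rewrite [u ^+ 2]expr2; apply: (cvg_trans _ h2); apply: near_eq_cvg; near=> r.
have rp : 0 < r by near: r; exact: nbhs_right_gt.
have r0 : r != 0 by rewrite gt_eqF.
have pq : expR (r * (u / 2)) * expR (- (r * (u / 2))) = 1.
  by rewrite expRN divff// gt_eqF// expR_gt0.
have e1 : expR (r * u) = expR (r * (u / 2)) ^+ 2.
  by rewrite expr2 -expRD; congr expR; field.
have e2 : expR (- (r * u)) = expR (- (r * (u / 2))) ^+ 2.
  by rewrite expr2 -expRD; congr expR; field.
rewrite /cosh e1 e2 /G.
have := pq; set p := expR (r * (u / 2)); set q := expR (- (r * (u / 2))) => pq'.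
have -> : (p ^+ 2 + q ^+ 2) / 2 - 1 = (p - q) ^+ 2 / 2.
  by rewrite sqrrB pq'; field.
by field.
Unshelve. all: by end_near.
Qed.

Lemma seq_bounded_above (r : nat -> R) (l : R) : r n @[n --> \oo] --> l ->
  exists2 B, 0 < B & forall n, r n <= B.
Proof.
move=> rl; have /cvg_seq_bounded [M [_ hM]] : cvgn r by apply/cvg_ex; exists l.
exists (`|M| + 1); first by rewrite ltr_wpDl.
move=> n; rewrite (le_trans (ler_norm _))//; apply: hM => //.
by rewrite (le_lt_trans (ler_norm _))// ltrDl.
Qed.

(** In terms of x = 2 / r^2 this is K_n(x) ~ sqrt(pi / (2 x)) exp(- x), the same for every n: after
    w = r u the factor exp(n r u) tends to 1 and the rest tends to exp(- u^2). *)
Lemma besselK_asymptotics (n : nat) :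
  expR (2 / r ^+ 2) * besselK n (2 / r ^+ 2) / r @[r --> (0 : R)^'+]
    --> Num.sqrt pi / 2.
Proof.
have cc := @continuous_cosh R.
pose f (r u : R) := expR (n%:R * (r * u) - 2 / r ^+ 2 * (cosh (r * u) - 1)).
have E (r : R) : 0 < r ->
    expR (2 / r ^+ 2) * besselK n (2 / r ^+ 2) / r = 2^-1 * \int[leb]_u f r u.
  move=> r0; have x0 : 0 < 2 / r ^+ 2 by rewrite divr_gt0// exprn_gt0.
  have := Rintegral_expM_cosh n x0.
  rewrite /Rintegral (@integral_affine _ _ 0 r)//; last by cont.
  set J := fine _ => hJ.
  have -> : besselK n (2 / r ^+ 2) = 2^-1 * J by rewrite hJ mulKf.
  suff -> : J = r * expR (- (2 / r ^+ 2)) * \int[leb]_u f r u.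
    rewrite expRN; have := expR_gt0 (2 / r ^+ 2); set e := expR _ => e0.
    by rewrite /Rintegral; set I0 := fine _; field; rewrite !gt_eqF.
  rewrite -RintegralZl//.
    apply: (congr1 fine); apply: eq_integral => u _; congr (_%:E).
    rewrite add0r /f mulrC -mulrA -expRD; congr (r * expR _).
    by ring.
  have i := L1_expM_cosh (n%:R * r) x0.
  have B1 (u : R) : 2 / r ^+ 2 * (1 + (r * u) ^+ 2 / 8) <= 2 / r ^+ 2 * cosh (r * u).
    by rewrite ler_pM2l// cosh_ge.
  apply: (@L1_exp_bound _ _ 1 (expR ((n%:R * r + 1) ^+ 2 / (4 * (1 / 4))))) => //.
    by apply: continuous_measurable_fun; rewrite /f; cont.
  move=> u; rewrite ger0_norm ?expR_ge0// /f -expRD ler_expR mul1r.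
  (* The rate 1 / 4 is 2 / r^2 times (r u)^2 / 8 from [cosh_ge], with the scale r cancelled. *)
  have := @quad_exp_le _ (1 / 4) (n%:R * r) `|u| ltac:(lra).
  rewrite real_normK ?num_real// => hq.
  have : n%:R * (r * u) <= n%:R * r * `|u| by rewrite mulrA ler_wpM2l ?ler_norm// mulr_ge0// ltW.
  have := B1 u.
  have -> : 2 / r ^+ 2 * (1 + (r * u) ^+ 2 / 8) = 2 / r ^+ 2 + u ^+ 2 / 4.
    by field; rewrite gt_eqF.
  lra.
apply/cvg_at_rightP => r [r0 rc].
under eq_fun do rewrite E//.
have -> : Num.sqrt pi / 2 = 2^-1 * \int[leb]_u expR (- u ^+ 2).
  by rewrite mulrC /Rintegral integralT_gauss.
apply: cvgMr.
(* An upper bound of the sequence r makes the linear term n r u, hence the majorant, uniform in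
   k. *)
have [B B0 rB] := seq_bounded_above rc.
have ig : L1 (fun u => expR ((n%:R * B + 1) ^+ 2 / (4 * (1 / 4))) * expR (- (1 * `|u|))).
  exact: (integrableZl measurableT _ (L1_expNMabs ltr01)).
apply: (dominated_cvg_Rintegral measurableT _ _ ig).
- by move=> k; apply: continuous_measurable_fun; rewrite /f; cont.
- move=> u _; rewrite /f; apply: continuous_cvg; first exact: continuous_expR.
  rewrite -[X in _ --> X]add0r; apply: cvgB.
    rewrite -(mulr0 n%:R) -(mul0r u); apply: cvgMr; apply: cvgMl; exact: rc.
  by have /cvg_at_rightP := @cvg_cosh_gauss u; apply; split.
- move=> k u _; rewrite ger0_norm ?expR_ge0// /f -expRD ler_expR mul1r.
  have := @quad_exp_le _ (1 / 4) (n%:R * B) `|u| ltac:(lra).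
  rewrite real_normK ?num_real// => hq.
  have h1 : n%:R * (r k * u) <= n%:R * B * `|u|.
    apply: (@le_trans _ _ (n%:R * r k * `|u|)).
      by rewrite mulrA ler_wpM2l ?ler_norm// mulr_ge0// ltW.
    by rewrite ler_wpM2r// ler_wpM2l.
  have x0 : 0 < 2 / r k ^+ 2 by rewrite divr_gt0// exprn_gt0.
  have B1 : 2 / r k ^+ 2 * (1 + (r k * u) ^+ 2 / 8) <= 2 / r k ^+ 2 * cosh (r k * u).
    by rewrite ler_pM2l// cosh_ge.
  move: B1.
  have -> : 2 / r k ^+ 2 * (1 + (r k * u) ^+ 2 / 8) = 2 / r k ^+ 2 + u ^+ 2 / 4.
    by field; rewrite gt_eqF.
  lra.
Qed.

End BesselKLimits.

(** * Limits of I *)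

Section BesselI.
Variable R : realType.
Local Notation leb := (@lebesgue_measure R).
Local Notation pi := (@pi R).

Lemma integrable_0pi (f : R -> R) (b : R) : continuous f ->
  leb.-integrable `[0, b] (EFin \o f).
Proof.
move=> cf; apply: continuous_compact_integrable; first exact: segment_compact.
exact: continuous_subspaceT.
Qed.

(** What remains of exp(x cos t) cos(n t) when the exponential series is integrated term by term. *)
Definition cosmom (m n : nat) : R :=
  \int[leb]_(t in `[0, pi]) (cos t ^+ m * cos (n%:R * t)).

Lemma sin_natpi (n : nat) : sin (n%:R * pi) = 0.
Proof.
elim: n => [|n ih]; first by rewrite mul0r sin0.
by rewrite -natr1 mulrDl mul1r sinD ih sinpi mul0r mulr0 addr0.
Qed.

Lemma cosmom00 : cosmom 0 0 = pi.
Proof.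
rewrite /cosmom; transitivity (\int[leb]_(t in `[0, pi]) (1 : R)).
  by apply: eq_Rintegral => t _; rewrite expr0 mul0r cos0 mulr1.
rewrite Rintegral_cst; last exact: measurable_itv.
have E := @lebesgue_measure_itv R `[0, pi]%R.
rewrite /= lte_fin pi_gt0 in E.
by rewrite [X in fine X]E /= subr0 mul1r.
Qed.

Lemma cosmom0S (n : nat) : cosmom 0 n.+1 = 0.
Proof.
have n0 : n.+1%:R != 0 :> R by rewrite pnatr_eq0.
pose F (t : R) := sin (n.+1%:R * t) / n.+1%:R.
have dF (t : R) : is_derive t 1 F (cos t ^+ 0 * cos (n.+1%:R * t)).
  by rewrite /F; apply: is_derive_eq; rewrite /GRing.scale/=; field.
have cF (x : R) : {for x, continuous F}.
  by apply/differentiable_continuous/derivable1_diffP; case: (dF x).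
rewrite /cosmom /Rintegral (@continuous_FTC2 _ _ F)//.
- by rewrite /F sin_natpi mulr0 sin0 !mul0r /= subrr.
- exact: pi_gt0.
- by apply: continuous_subspaceT; cont.
- split.
  + by move=> x _; case: (dF x).
  + by apply: cvg_at_right_filter; exact: cF.
  + by apply: cvg_at_left_filter; exact: cF.
- by move=> x _; rewrite derive1E derive_val.
Qed.

Lemma cosmomS0 (m : nat) : cosmom m.+1 0 = cosmom m 1.
Proof.
apply: eq_Rintegral => t _; rewrite !mul0r cos0 mul1r mulr1 exprSr//.
Qed.

Lemma cosmomSS (m n : nat) : cosmom m.+1 n.+1 = (cosmom m n.+2 + cosmom m n) / 2.
Proof.
have mD : measurable `[0, pi]%classic by exact: measurable_itv.
have i k : leb.-integrable `[0, pi] (EFin \o (fun t => cos t ^+ m * cos (k%:R * t))).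
  by apply: integrable_0pi; have cc := @continuous_cos R; cont.
rewrite /cosmom -RintegralD// -RintegralZr//; last first.
  by apply: integrable_0pi; have cc := @continuous_cos R; cont.
apply: eq_Rintegral => t _; rewrite exprSr.
have -> : n.+2%:R * t = n.+1%:R * t + t by rewrite -[n.+2%:R]natr1; ring.
have -> : n%:R * t = n.+1%:R * t - t by rewrite -[n.+1%:R]natr1; ring.
by rewrite cosD cosB; field.
Qed.

(** Expanding cos^m t into exponentials gives the frequencies m - 2 k with binomial weights, so n is
    met only when m - n is even and nonnegative. In the induction [cosmomSS] plays the part of
    Pascal's rule. *)
Lemma cosmom_bin (m n : nat) :
  (forall k, m = (n + k.*2)%N -> cosmom m n = pi * 'C(m, k)%:R / 2 ^+ m) /\
  ((forall k, m <> (n + k.*2)%N) -> cosmom m n = 0).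
Proof.
elim: m n => [|m ih] [|n]; split.
- case=> [_|k]; last by rewrite doubleS.
  by rewrite cosmom00 bin0 expr0 divr1 mulr1.
- by move=> /(_ 0%N).
- by move=> k; rewrite addSn.
- by move=> _; exact: cosmom0S.
- case=> [|k]; first by rewrite double0.
  rewrite doubleS add0n => -[mk]; rewrite cosmomS0.
  have mk1 : m = (1 + k.*2)%N by rewrite mk.
  rewrite ((ih 1%N).1 k mk1) binS.
  (* Here m = 2 k + 1, so the two central coefficients agree and Pascal's rule merely doubles one of
     them. *)
  have -> : 'C(m, k.+1) = 'C(m, k).
    rewrite -(@bin_sub m k); last by rewrite mk1; lia.
    by congr ('C(m, _)); rewrite mk1; lia.
  by rewrite natrD exprS; field; rewrite expf_neq0.
- move=> h; rewrite cosmomS0 (ih 1%N).2// => k mk; apply: (h k.+1).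
  by rewrite mk doubleS; lia.
- move=> k; rewrite addSn => -[mk]; rewrite cosmomSS ((ih n).1 k mk).
  case: k mk => [|k] mk.
    (* For k = 0 the degree m equals n, and the frequency n + 2 exceeds it. *)
    rewrite (ih n.+2).2; last by move=> k; rewrite mk double0; lia.
    by rewrite !bin0 add0r exprS; field; rewrite expf_neq0.
  rewrite ((ih n.+2).1 k); last by rewrite mk doubleS; lia.
  by rewrite binS natrD exprS; field; rewrite expf_neq0.
- move=> h; rewrite cosmomSS (ih n).2; last by move=> k mk; apply: (h k); rewrite mk.
  rewrite (ih n.+2).2 ?addr0 ?mul0r// => k mk; apply: (h k.+1).
  by rewrite mk doubleS; lia.
Qed.

Lemma series_exp_le (x : R) (n : nat) :
  \sum_(0 <= m < n) `|x| ^+ m / m`!%:R <= expR `|x|.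
Proof.
have := @nondecreasing_cvgn_le _ (series (exp_coeff `|x|)) _ _ n; apply.
- by apply: nondecreasing_series => k _ _; rewrite divr_ge0// exprn_ge0.
- exact: is_cvg_series_exp_coeff.
Qed.

Definition besselI_term (n : nat) (x : R) (k : nat) : R :=
  (x / 2) ^+ (2 * k + n) / (k`! * (k + n)`!)%:R.

(** Only the indices m = n + 2 k contribute, and there C(m, k) / m! = 1 / (k! (k + n)!). Cutting the
    exponential series at n + 2 K therefore leaves exactly K terms of the Bessel series. *)
Lemma Rintegral_exp_partial (n K : nat) (x : R) :
  \sum_(0 <= m < n + K.*2) (x ^+ m / m`!%:R * cosmom m n)
  = pi * \sum_(0 <= k < K) besselI_term n x k.
Proof.
have fne k : k`!%:R != 0 :> R by rewrite pnatr_eq0 -lt0n fact_gt0.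
elim: K => [|K ih].
  rewrite double0 addn0 big_nil mulr0 big_nat_cond big1// => m; rewrite andbT => mn.
  by rewrite (cosmom_bin m n).2 ?mulr0// => k mk; move: mn; rewrite mk; lia.
rewrite doubleS !addnS big_nat_recr//= big_nat_recr//= ih big_nat_recr//= mulrDr.
rewrite [X in _ + X]mulrC -addrA; congr (_ + _).
(* Of the two new indices the second has the wrong parity. *)
rewrite (cosmom_bin (n + K.*2).+1 n).2 ?mul0r ?addr0; last by move=> k; lia.
rewrite ((cosmom_bin (n + K.*2) n).1 K)// /besselI_term.
have bf : ('C(n + K.*2, K) * (K`! * (K + n)`!))%N = (n + K.*2)`!.
  have -> : (K + n = n + K.*2 - K)%N by lia.
  by apply: bin_fact; lia.
rewrite -bf mul2n addnC natrM exprMn exprVn !natrM.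
have C0 : 'C(n + K.*2, K)%:R != 0 :> R.
  by rewrite pnatr_eq0 -lt0n bin_gt0; lia.
rewrite addnC in C0.
by field; rewrite !fne C0 expf_neq0.
Qed.

(** Bessel's integral. The partial exponential sums converge under the constant majorant exp |x|,
    and the Bessel partial sums are their integrals along the subsequence n + 2 K, divided by pi. *)
Lemma besselI_cvg (n : nat) (x : R) :
  series (besselI_term n x) K @[K --> \oo] -->
  \int[leb]_(t in `[0, pi]) (expR (x * cos t) * cos (n%:R * t)) / pi.
Proof.
have mD : measurable `[0, pi]%classic by exact: measurable_itv.
pose T (M : nat) (t : R) := (\sum_(0 <= m < M) (x * cos t) ^+ m / m`!%:R) * cos (n%:R * t).
have cT M : continuous (T M).
  have cs : continuous (fun t => \sum_(0 <= m < M) (x * cos t) ^+ m / m`!%:R).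
    elim: M => [|M ih].
      have -> : (fun t : R => \sum_(0 <= m < 0) (x * cos t) ^+ m / m`!%:R) = cst 0.
        by apply/funext => t; rewrite big_nil.
      by move=> t; exact: cvg_cst.
    have -> : (fun t : R => \sum_(0 <= m < M.+1) (x * cos t) ^+ m / m`!%:R)
        = (fun t => \sum_(0 <= m < M) (x * cos t) ^+ m / m`!%:R + (x * cos t) ^+ M / M`!%:R).
      by apply/funext => t; rewrite big_nat_recr.
    set S := fun t => \sum_(0 <= m < M) _ in ih *.
    by move=> t; apply: cont_add; [exact: ih|cont].
  by move=> t; apply: cont_mul; [exact: cs|cont].
have h1 : \int[leb]_(t in `[0, pi]) T M t @[M --> \oo] -->
    \int[leb]_(t in `[0, pi]) (expR (x * cos t) * cos (n%:R * t)).
  apply: (@dominated_cvg_Rintegral _ _ _ _ (cst (expR `|x|))) => //.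
  - by move=> M; apply: measurable_funTS; apply: continuous_measurable_fun.
  - by move=> t _; apply: cvgMl; exact: is_cvg_series_exp_coeff.
  - by apply: integrable_0pi; move=> t; exact: cvg_cst.
  - move=> M t _; rewrite normrM /= (le_trans (ler_piMr _ (cos_max _)))//.
    rewrite (le_trans _ (series_exp_le x M))// (le_trans (ler_norm_sum _ _ _))//.
    apply: ler_sum => m _; rewrite normrM normfV [`|m`!%:R|]ger0_norm// ler_wpM2r ?invr_ge0//.
    by rewrite normrX normrM lerXn2r ?nnegrE ?mulr_ge0// ler_piMr// cos_max.
have E M : \int[leb]_(t in `[0, pi]) T M t = \sum_(0 <= m < M) (x ^+ m / m`!%:R * cosmom m n).
  elim: M => [|M ih].
    rewrite big_nil; transitivity (\int[leb]_(t in `[0, pi]) (0 : R)).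
      by apply: eq_Rintegral => t _; rewrite /T big_nil mul0r.
    by rewrite Rintegral_cst// mul0r.
  rewrite big_nat_recr//= -ih /cosmom -RintegralZl//; last by apply: integrable_0pi; cont.
  rewrite -RintegralD//; first last.
  - by apply: integrable_0pi; cont.
  - by apply: integrable_0pi; exact: cT.
  apply: eq_Rintegral => t _; rewrite /T big_nat_recr//= exprMn; ring.
have h2 : \int[leb]_(t in `[0, pi]) T (n + K.*2)%N t @[K --> \oo] -->
    \int[leb]_(t in `[0, pi]) (expR (x * cos t) * cos (n%:R * t)).
  suff hc : (fun K : nat => (n + K.*2)%N) K @[K --> \oo] --> \oo.
    exact: (cvg_comp _ _ hc h1).
  apply/cvgnyPge => A; near=> K; apply: (@leq_trans K); last by lia.
  by near: K; exact: nbhs_infty_ge.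
have pi0 : pi != 0 by rewrite gt_eqF// pi_gt0.
have -> : series (besselI_term n x) = (fun K => (\int[leb]_(t in `[0, pi]) T (n + K.*2)%N t) / pi).
  by apply/funext => K; rewrite E Rintegral_exp_partial mulrC mulKf.
exact: cvgMl.
Unshelve. all: by end_near.
Qed.

Lemma besselIE (n : nat) (x : R) :
  besselI n x = \int[leb]_(t in `[0, pi]) (expR (x * cos t) * cos (n%:R * t)) / pi.
Proof. by apply/cvg_lim => //; exact: besselI_cvg. Qed.

End BesselI.

(** * Behaviour of I_n at zero and at infinity *)

Section BesselILimits.
Variable R : realType.
Local Notation leb := (@lebesgue_measure R).
Local Notation pi := (@pi R).

(** All terms are nonnegative: the first one is the lower bound, and (k + n)! >= n! compares the
    series with that of exp((x / 2)^2). *)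
Lemma besselI_bounds (n : nat) (x : R) : 0 <= x ->
  (x / 2) ^+ n / n`!%:R <= besselI n x <=
  (x / 2) ^+ n / n`!%:R * expR ((x / 2) ^+ 2).
Proof.
move=> x0; have z0 : 0 <= x / 2 by rewrite divr_ge0.
have fp k : 0 < k`!%:R :> R by rewrite ltr0n fact_gt0.
have t0 k : 0 <= besselI_term n x k.
  by rewrite /besselI_term divr_ge0// exprn_ge0.
have cv : cvgn (series (besselI_term n x)).
  by apply/cvg_ex; eexists; exact: besselI_cvg.
have nd : {homo series (besselI_term n x) : a b / (a <= b)%N >-> a <= b}.
  exact: nondecreasing_series.
apply/andP; split.
  have := nondecreasing_cvgn_le nd cv 1%N.
  rewrite /series/= big_nat1 {1}/besselI_term muln0 !add0n fact0 mul1n.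
  by apply.
apply: limr_le => //; near=> K.
rewrite /series/=.
apply: (@le_trans _ _ (\sum_(0 <= k < K) (x / 2) ^+ n / n`!%:R * (`|(x / 2) ^+ 2| ^+ k / k`!%:R))).
  apply: ler_sum => k _; rewrite /besselI_term exprD exprM natrM.
  rewrite [X in _ <= _ * (X ^+ k / _)]ger0_norm ?sqr_ge0//.
  have A0 : 0 <= ((x / 2) ^+ 2) ^+ k by rewrite exprn_ge0// sqr_ge0.
  have B0 : 0 <= (x / 2) ^+ n by rewrite exprn_ge0.
  set A := (_ ^+ k) in A0 *; set B := (_ ^+ n) in B0 *.
  have -> : B / n`!%:R * (A / k`!%:R) = A * B / (k`!%:R * n`!%:R).
    by field; rewrite !gt_eqF.
  rewrite ler_wpM2l ?mulr_ge0// lef_pV2 ?posrE ?mulr_gt0// ler_pM2l//.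
  by rewrite ler_nat leq_fact// leq_addl.
rewrite -mulr_sumr ler_wpM2l ?divr_ge0 ?exprn_ge0//.
by rewrite (le_trans (series_exp_le _ _))// ger0_norm ?sqr_ge0.
Unshelve. all: by end_near.
Qed.

Lemma besselI_small (n : nat) (s : R) : 0 <= s ->
  besselI n (2 * d * s) / d ^+ n @[d --> (0 : R)^'+] --> s ^+ n / n`!%:R.
Proof.
move=> s0.
have h : s ^+ n / n`!%:R * expR ((d * s) ^+ 2) @[d --> (0 : R)^'+] --> s ^+ n / n`!%:R.
  pose g (d : R) := s ^+ n / n`!%:R * expR ((d * s) ^+ 2).
  have g0 : g 0 = s ^+ n / n`!%:R by rewrite /g mul0r expr0n expR0 mulr1.
  have cg : continuous g by rewrite /g; cont.
  by rewrite -[X in _ --> X]g0; apply: cvg_at_right_filter; exact: cg.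
apply: (squeeze_cvgr _ (cvg_cst (s ^+ n / n`!%:R)) h).
near=> d; have d0 : 0 < d by near: d; exact: nbhs_right_gt.
have x0 : 0 <= 2 * d * s by rewrite !mulr_ge0// ltW.
have := besselI_bounds n x0.
have -> : 2 * d * s / 2 = d * s by field.
have -> : (d * s) ^+ n / n`!%:R = s ^+ n / n`!%:R * d ^+ n by rewrite exprMn; ring.
rewrite ler_pdivlMr ?exprn_gt0// ler_pdivrMr ?exprn_gt0//.
by rewrite (mulrAC _ (d ^+ n)).
Unshelve. all: by end_near.
Qed.

(** This is s <= tan s without the denominator; sin x - x cos x has derivative x sin x. *)
Lemma sin_ge_mul_cos (s : R) : 0 <= s <= pi / 2 -> s * cos s <= sin s.
Proof.
move=> /andP[s0 sp].
pose f (x : R) := sin x - x * cos x.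
have df (x : R) : is_derive x 1 f (x * sin x).
  by rewrite /f; apply: is_derive_eq; rewrite /GRing.scale/=; ring.
have cf : continuous f.
  by move=> x; apply/differentiable_continuous/derivable1_diffP; case: (df x).
suff : f 0 <= f s by rewrite /f sin0 mul0r subrr subr_ge0.
apply: (@ger0_derive1_le_cc _ f 0 s) => //.
- move=> x; rewrite in_itv/= => /andP[x0 xs]; rewrite derive1E derive_val.
  rewrite mulr_ge0 ?ltW// sin_gt0_pi// x0/=.
  by rewrite (lt_le_trans xs)// (le_trans sp)// ler_pdivrMr// ler_peMr ?pi_ge0//; lra.
- exact: continuous_subspaceT.
- by rewrite in_itv/= lexx.
- by rewrite in_itv/= s0 lexx.
Qed.

(** Here 1 - cos t = 2 sin^2(t / 2), and sin(t / 2) = 2 sin(t / 4) cos(t / 4) >= (t / 2) cos^2(t /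
    4) >= t / 4, as cos^2(t / 4) >= 1 / 2 up to t = pi. The constant is not sharp; what matters is a
    quadratic bound on the whole interval. *)
Lemma onem_cos_ge (t : R) : 0 <= t <= pi -> t ^+ 2 / 32 <= 1 - cos t.
Proof.
move=> /andP[t0 tp]; have p0 := pi_gt0 R.
have cos2 (x : R) : cos (x *+ 2) = 2 * cos x ^+ 2 - 1 by rewrite cos_mulr2n mulr_natl.
have sin2 (x : R) : sin (x *+ 2) = 2 * (cos x * sin x) by rewrite sin_mulr2n mulr_natl.
have c0 : 0 <= cos (t / 2) by apply: cos_ge0_pihalf; apply/andP; split; lra.
have c1 : 0 <= cos (t / 4) by apply: cos_ge0_pihalf; apply/andP; split; lra.
have e2 : cos (t / 2) = 2 * cos (t / 4) ^+ 2 - 1.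
  by rewrite -cos2; congr cos; rewrite -mulr_natr; field.
have e1 : cos t = 2 * cos (t / 2) ^+ 2 - 1.
  by rewrite -cos2; congr cos; rewrite -mulr_natr; field.
have es : sin (t / 2) = 2 * (cos (t / 4) * sin (t / 4)).
  by rewrite -sin2; congr sin; rewrite -mulr_natr; field.
have s4 : t / 4 * cos (t / 4) <= sin (t / 4) by apply: sin_ge_mul_cos; apply/andP; split; lra.
have ch : 1 / 2 <= cos (t / 4) ^+ 2 by lra.
have sh : t / 4 <= sin (t / 2).
  rewrite es.
  have : t / 4 * cos (t / 4) * cos (t / 4) <= sin (t / 4) * cos (t / 4) by rewrite ler_wpM2r.
  have : t / 4 * (1 / 2) <= t / 4 * cos (t / 4) ^+ 2 by rewrite ler_wpM2l// divr_ge0.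
  lra.
have : (t / 4) ^+ 2 <= sin (t / 2) ^+ 2 by rewrite lerXn2r ?nnegrE ?divr_ge0// (le_trans _ sh)// divr_ge0.
have h3 : (t / 4) ^+ 2 = t ^+ 2 / 16 by field.
have h4 := cos2Dsin2 (t / 2); have h5 := sqr_ge0 t.
rewrite h3 e1; move: h4 h5; set C := _ ^+ 2; set S := _ ^+ 2; set T := t ^+ 2; lra.
Qed.

(** As for cosh, a squared difference quotient at 0, now of G r = 2 sin(r u / 2). *)
Lemma cvg_cos_gauss (u : R) :
  2 / r ^+ 2 * (1 - cos (r * u)) @[r --> 0^'+] --> u ^+ 2.
Proof.
pose G (r : R) := 2 * sin (r * (u / 2)).
have dG : is_derive (0 : R) 1 G u.
  rewrite /G; apply: is_derive_eq.
  by rewrite /GRing.scale/= mul0r cos0; field.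
have G0 : G 0 = 0 by rewrite /G mul0r sin0 mulr0.
have h := cvg_quotient_at_right0 dG G0.
have h2 : (G r / r) * (G r / r) @[r --> 0^'+] --> u * u by exact: (cvgM h h).
rewrite [u ^+ 2]expr2; apply: (cvg_trans _ h2); apply: near_eq_cvg; near=> r.
have rp : 0 < r by near: r; exact: nbhs_right_gt.
have r0 : r != 0 by rewrite gt_eqF.
have -> : cos (r * u) = 1 - 2 * sin (r * (u / 2)) ^+ 2.
  have -> : r * u = (r * (u / 2)) *+ 2 by rewrite -mulr_natr; field.
  rewrite cos_mulr2n mulr2n; have := cos2Dsin2 (r * (u / 2)); lra.
by rewrite /G; field.
Unshelve. all: by end_near.
Qed.

(** In terms of x = 2 / r^2 this is I_n(x) ~ exp x / sqrt(2 pi x). The substitution t = r u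
    stretches [0, pi] to [0, pi / r]; extension by zero puts all these integrals on one
    half-line. *)
Lemma besselI_asymptotics (n : nat) :
  expR (- (2 / r ^+ 2)) * besselI n (2 / r ^+ 2) / r @[r --> (0 : R)^'+]
    --> Num.sqrt pi / 2 / pi.
Proof.
have p0 := pi_gt0 R.
pose f (r u : R) := expR (- (2 / r ^+ 2 * (1 - cos (r * u)))) * cos (n%:R * (r * u)).
have cf (r : R) : continuous (f r) by rewrite /f; cont.
pose D := `[0 : R, +oo[%classic.
have mD : measurable D by exact: measurable_itv.
have E (r : R) : 0 < r ->
    expR (- (2 / r ^+ 2)) * besselI n (2 / r ^+ 2) / r
    = (\int[leb]_(u in D) (f r \_ `[0, pi / r]) u) / pi.
  move=> r0.
  have pr : 0 < pi / r by rewrite divr_gt0.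
  have -> : \int[leb]_(u in D) (f r \_ `[0, pi / r]) u = \int[leb]_(u in `[0, pi / r]) f r u.
    rewrite -Rintegral_mkcondr setIidr// => u /=; rewrite /D/= !in_itv/= andbT.
    by case/andP.
  rewrite besselIE.
  have -> : \int[leb]_(t in `[0, pi]) (expR (2 / r ^+ 2 * cos t) * cos (n%:R * t))
      = \int[leb]_(u in `[0, pi / r]) (expR (2 / r ^+ 2) * r * f r u).
    pose F (u : R) := r * u.
    have dF (u : R) : is_derive u 1 F r.
      by rewrite /F; apply: is_derive_eq; rewrite /GRing.scale/=; ring.
    have F'E : derive1 F = cst r by apply/funext => u; rewrite derive1E derive_val.
    have cF : continuous F by rewrite /F; cont.
    have -> : `[0, pi]%classic = `[F 0, F (pi / r)]%classic :> set R.
      by rewrite /F mulr0 mulrCA divff ?gt_eqF// mulr1.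
    apply: (congr1 fine); rewrite integration_by_substitution_increasing//.
    - apply: eq_integral => u _; rewrite F'E /= /f /F; congr (_%:E).
      transitivity (expR (2 / r ^+ 2 * cos (r * u)) * cos (n%:R * (r * u)) * r) => //.
      have -> : expR (2 / r ^+ 2 * cos (r * u))
          = expR (2 / r ^+ 2) * expR (- (2 / r ^+ 2 * (1 - cos (r * u)))).
        by rewrite -expRD; congr expR; ring.
      by ring.
    - exact: (ltW pr).
    - by move=> x y _ _ xy; rewrite /F ltr_pM2l.
    - by rewrite F'E => x _; exact: cvg_cst.
    - by rewrite F'E; exact: is_cvg_cst.
    - by rewrite F'E; exact: is_cvg_cst.
    - split.
      + by move=> x _; case: (dF x).
      + by apply: cvg_at_right_filter; exact: cF.
      + by apply: cvg_at_left_filter; exact: cF.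
    - by apply: continuous_subspaceT; cont.
  rewrite RintegralZl//; last exact: integrable_0pi.
  rewrite expRN; have := expR_gt0 (2 / r ^+ 2); set e := expR _ => e0.
  by set X := Rintegral _ _ _; clearbody X; move: (pi^-1) => q; field; rewrite !gt_eqF.
have EG : Num.sqrt pi / 2 = \int[leb]_(u in D) expR (- u ^+ 2).
  by rewrite /Rintegral integral0y_gauss.
apply/cvg_at_rightP => r [r0 rc].
under eq_fun do rewrite E//.
rewrite EG; apply: cvgMl.
(* The rate 1 / 16 is 2 / r^2 times (r u)^2 / 32 from [onem_cos_ge]; the summand 0 is the linear
   coefficient in [quad_exp_le]. *)
have ig : leb.-integrable D (EFin \o (fun u => expR ((0 + 1) ^+ 2 / (4 * (1 / 16))) * expR (- (1 * `|u|)))).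
  exact: integrableS (integrableZl measurableT _ (L1_expNMabs ltr01)).
apply: (dominated_cvg_Rintegral mD _ _ ig).
- move=> k; apply: measurable_funTS.
  apply/(measurable_restrictT _ (measurable_itv `[0, pi / r k])); apply: measurable_funTS.
  exact: continuous_measurable_fun.
- move=> u; rewrite /D/= in_itv/= andbT => u0.
  have h : f (r k) u @[k --> \oo] --> expR (- u ^+ 2).
    rewrite -[X in _ --> X]mulr1 /f; apply: cvgM.
      apply: continuous_cvg; first exact: continuous_expR.
      by apply: cvgN; have /cvg_at_rightP := @cvg_cos_gauss u; apply; split.
    rewrite -[X in _ --> X]cos0; apply: continuous_cvg; first exact: continuous_cos.
    by rewrite -(mulr0 n%:R) -(mul0r u); apply: cvgMr; apply: cvgMl; exact: rc.
  (* For fixed u the cut-off is eventually invisible: r k <= pi / (u + 1) forces u <= pi / r k. The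
     summand 1 covers u = 0. *)
  have hu : 0 < pi / (u + 1) by rewrite divr_gt0// ltr_wpDl.
  apply: (cvg_trans _ h); apply: near_eq_cvg; near=> k.
  rewrite patchE ifT// inE /= in_itv/= u0/= ler_pdivlMr//.
  have : r k <= pi / (u + 1).
    by near: k; apply: (cvgr_le _ rc).
  rewrite ler_pdivlMr ?ltr_wpDl//; have := r0 k; nra.
- move=> k u; rewrite /D/= in_itv/= andbT => u0.
  rewrite patchE; case: ifPn => [|_]; last by rewrite normr0 mulr_ge0 ?expR_ge0.
  rewrite inE/= in_itv/= => /andP[_ up].
  rewrite /f normrM ger0_norm ?expR_ge0// (le_trans (ler_piMr _ (cos_max _))) ?expR_ge0//.
  rewrite -expRD ler_expR mul1r ger0_norm//.
  have := @quad_exp_le _ (1 / 16) 0 u ltac:(lra); rewrite mul0r addr0.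
  have ru : 0 <= r k * u <= pi.
    by rewrite mulr_ge0 ?(ltW (r0 k))//= mulrC -ler_pdivlMr.
  have := onem_cos_ge ru.
  have x0 : 0 < 2 / r k ^+ 2 by rewrite divr_gt0// exprn_gt0.
  rewrite -(ler_pM2l x0).
  have -> : 2 / r k ^+ 2 * ((r k * u) ^+ 2 / 32) = 1 / 16 * u ^+ 2.
    by field; rewrite gt_eqF.
  lra.
Unshelve. all: by end_near.
Qed.

(** * Gamma at the positive integers *)

Lemma phi_cvg0 (c : R) : 0 < c ->
  phi c n.+1%:R @[n --> \oo] --> (0 : R) /\ phi c (- n.+1%:R) @[n --> \oo] --> (0 : R).
Proof.
move=> c0; have [] := phi_mul_cvg0 (g := cst 1) c0.
  by move=> x; rewrite /= normr1.
by split; [under eq_fun do rewrite -[phi _ _]mulr1|under eq_fun do rewrite -[phi _ _]mulr1].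
Qed.

Lemma GammaE (c : R) : Gamma c = \int[leb]_u phi c u.
Proof.
rewrite /Gamma /Rintegral integral_expR.
  congr fine; apply: eq_integral => u _; congr (_%:E).
  rewrite /powR gt_eqF ?expR_gt0// expRK /phi -!expRD; congr expR; ring.
move=> x; rewrite in_itv/= andbT => x0.
apply: cont_mul; last by cont.
by apply: differentiable_continuous; apply/derivable1_diffP; apply: derivable_powR; rewrite in_itv/= andbT.
Qed.

Lemma GammaS (c : R) : 0 < c -> Gamma (c + 1) = c * Gamma c.
Proof.
move=> c0; have c10 : 0 < c + 1 by rewrite addr_gt0.
have [p1 p2] := phi_cvg0 c0.
have cp := @continuous_phi R c; have cp1 := @continuous_phi R (c + 1).
have i1 := integrableZl measurableT c (L1_phi c0).
rewrite !GammaE -RintegralZl//; last exact: L1_phi.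
apply/esym/eqP; rewrite -subr_eq0 -RintegralB//; last exact: L1_phi.
apply/eqP; apply: (@Rintegral_derive0 _ (phi c)) => //.
- by move=> x; exact: is_derive_phi.
- by cont.
- exact: (integrableB measurableT i1 (L1_phi c10)).
Qed.

Lemma Gamma1 : Gamma 1 = 1 :> R.
Proof.
transitivity (\int[leb]_(t in `]0, +oo[) expR (- t)).
  by apply: eq_Rintegral => t _; rewrite subrr powRr0 mul1r.
rewrite Rintegral_itv_obnd_cbnd; last first.
  apply: (@le_L1 _ _ _ (fun t => expR (- (1 * `|t|)))).
  - exact: measurable_itv.
  - by apply: measurable_funTS; apply: continuous_measurable_fun; cont.
  - exact: integrableS (L1_expNMabs ltr01).
  - move=> t /=; rewrite in_itv/= andbT => t0.
    by rewrite mul1r (gtr0_norm t0) ger0_norm ?expR_ge0.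
pose F (t : R) := - expR (- t).
have dF (t : R) : is_derive t 1 F (expR (- t)).
  by rewrite /F; apply: is_derive_eq; rewrite /GRing.scale/=; ring.
rewrite (@Rintegral_ge0_continuous_FTC2y _ _ F 0 0).
- by rewrite /F oppr0 expR0 sub0r opprK.
- by move=> t _; exact: expR_ge0.
- by apply: continuous_subspaceT; cont.
- by rewrite -oppr0; apply: cvgN; exact: cvgr_expR.
- by move=> t _; case: (dF t).
- by apply: cvg_at_right_filter; apply/differentiable_continuous/derivable1_diffP; case: (dF 0).
- by move=> t _; rewrite derive1E derive_val.
Qed.

(** Serves to match the j! in the leading coefficient of I_j with the normalising constant, and to
    see that this constant is nonzero. *)
Lemma Gamma_nat (n : nat) : Gamma n.+1%:R = n`!%:R :> R.
Proof.
elim: n => [|n ih]; first by rewrite Gamma1.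
by rewrite -[n.+2%:R]natr1 GammaS ?ltr0n// ih factS natrM.
Qed.

End BesselILimits.

(** * Limits of the density *)

Section Determinants.
Variable R : realType.

Lemma det_row_scale (K : comNzRingType) (n : nat) (c : 'I_n -> K) (m : 'I_n -> 'I_n -> K) :
  \det (\matrix_(i, j) (c i * m i j)) = (\prod_i c i) * \det (\matrix_(i, j) m i j).
Proof.
have -> : \matrix_(i, j) (c i * m i j) = diag_mx (\row_i c i) *m (\matrix_(i, j) m i j).
  by rewrite mul_diag_mx; apply/matrixP => i j; rewrite !mxE.
by rewrite det_mulmx det_diag; congr (_ * _); apply: eq_bigr => i _; rewrite mxE.
Qed.

Lemma det_col_scale (K : comNzRingType) (n : nat) (c : 'I_n -> K) (m : 'I_n -> 'I_n -> K) :
  \det (\matrix_(i, j) (m i j * c j)) = (\prod_j c j) * \det (\matrix_(i, j) m i j).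
Proof.
have -> : \matrix_(i, j) (m i j * c j) = (\matrix_(i, j) m i j) *m diag_mx (\row_i c i).
  by rewrite mul_mx_diag; apply/matrixP => i j; rewrite !mxE.
rewrite det_mulmx det_diag mulrC; congr (_ * _).
by apply: eq_bigr => i _; rewrite mxE.
Qed.

Lemma cvg_prod_seq (T : Type) (F : set_system T) {FF : Filter F} (I : Type) (s : seq I)
    (f : I -> T -> R) (l : I -> R) :
  (forall i, f i t @[t --> F] --> l i) ->
  \prod_(i <- s) f i t @[t --> F] --> \prod_(i <- s) l i.
Proof.
move=> h; elim: s => [|i s ih].
  by rewrite big_nil; under eq_fun do rewrite big_nil; exact: cvg_cst.
by rewrite big_cons; under eq_fun do rewrite big_cons; apply: cvgM.
Qed.

Lemma cvg_sum_seq (T : Type) (F : set_system T) {FF : Filter F} (I : Type) (s : seq I)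
    (f : I -> T -> R) (l : I -> R) :
  (forall i, f i t @[t --> F] --> l i) ->
  \sum_(i <- s) f i t @[t --> F] --> \sum_(i <- s) l i.
Proof.
move=> h; elim: s => [|i s ih].
  by rewrite big_nil; under eq_fun do rewrite big_nil; exact: cvg_cst.
by rewrite big_cons; under eq_fun do rewrite big_cons; apply: cvgD.
Qed.

Lemma cvg_exprn (T : Type) (F : set_system T) {FF : Filter F} (f : T -> R) (l : R)
    (k : nat) : f t @[t --> F] --> l -> f t ^+ k @[t --> F] --> l ^+ k.
Proof.
move=> h; apply: (@cvg_comp _ _ _ f (fun x => x ^+ k) _ (nbhs l) _ h).
exact: exprn_continuous.
Qed.

Lemma cvg_det (T : Type) (F : set_system T) {FF : Filter F} (n : nat)
    (f : T -> 'I_n -> 'I_n -> R) (l : 'I_n -> 'I_n -> R) :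
  (forall i j, f t i j @[t --> F] --> l i j) ->
  \det (\matrix_(i, j) f t i j) @[t --> F] --> \det (\matrix_(i, j) l i j).
Proof.
move=> h; rewrite /determinant.
apply: cvg_sum_seq => s; apply: cvgMr; apply: cvg_prod_seq => i.
by rewrite mxE; under eq_fun do rewrite mxE; exact: h.
Qed.

(** In the order of [R[i]] a positive element is real, so the complex epsilons are the real ones. *)
Lemma cvg_real_complex (T : Type) (F : set_system T) {FF : Filter F} (f : T -> R) (l : R) :
  f t @[t --> F] --> l -> ((f t)%:C : R[i]^o) @[t --> F] --> (l%:C : R[i]^o).
Proof.
move=> /cvgrPdist_lt h; apply/cvgrPdist_lt => -[e e'] e0.
move: e0; rewrite ltcE /= => /andP[/eqP -> e0].
apply: filterS (h _ e0) => t ht.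
by rewrite -rmorphB normc_def /= expr0n addr0 sqrtr_sqr ltcR.
Qed.

Lemma cvg_to_at_right (T : Type) (F : set_system T) {FF : Filter F} (f : T -> R) (l : R) :
  f t @[t --> F] --> l -> (\forall t \near F, l < f t) -> f t @[t --> F] --> l^'+.
Proof.
move=> h fl P lP.
have hP : \forall t \near F, l < f t -> P (f t) by exact: (h _ lP).
suff : \forall t \near F, P (f t) by [].
by apply: filterS2 hP fl => t; apply.
Qed.

Lemma prod_expr_ord (n : nat) (d : R) : \prod_(j < n) d ^+ j = d ^+ ((n * n.-1) %/ 2).
Proof. by rewrite prodrXr divn2 -bin2 -bin2_sum big_mkord. Qed.

End Determinants.

(** * Normalisation and determinants at the two endpoints *)

Section Density.
Variable R : realType.
Local Notation pi := (@pi R).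

Lemma powR_half (n : nat) (x : R) : 0 <= x -> x `^ (n%:R / 2) = Num.sqrt x ^+ n.
Proof. by move=> x0; rewrite mulrC powRrM powR12_sqrt// powR_mulrn// sqrtr_ge0. Qed.

Lemma density_cvg1 (N nu : nat) (y : 'I_N -> R) : (forall i, 0 < y i) ->
  density nu mu y @[mu --> (1 : R)^'-] -->
  (N`!%:R / 2 ^+ N * \prod_(j < N) (Gamma (R := R) j.+1%:R * Gamma (R := R) (j.+1 + nu)%:R))^-1
  * \det (\matrix_(i < N, j < N) (y i ^+ j / j`!%:R))
  * \det (\matrix_(i < N, j < N)
      (y i `^ ((j + nu)%:R / 2) * besselK (j + nu) (2 * Num.sqrt (y i)))).
Proof.
move=> y0.
have s0 i : 0 < Num.sqrt (y i) by rewrite sqrtr_gt0.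
set G := \prod_(j < N) _; set p := ((N * N.-1) %/ 2)%N.
(* [ZN] without its power of delta. In [D1] the factor delta^j is divided out of column j, so the
   two powers cancel and each remaining factor has a finite limit. *)
pose W (mu : R) := N`!%:R * alpha mu ^+ (N * nu + p)
  / (2 ^+ N * (alpha mu ^+ 2 - delta mu ^+ 2) ^+ (N * nu + N ^ 2)) * G.
pose D1 (mu : R) := \det (\matrix_(i < N, j < N)
  (y i `^ (j%:R / 2) * (besselI j (2 * delta mu * Num.sqrt (y i)) / delta mu ^+ j))).
pose D2 (mu : R) := \det (\matrix_(i < N, j < N)
  (y i `^ ((j + nu)%:R / 2) * besselK (j + nu) (2 * alpha mu * Num.sqrt (y i)))).
have mu01 : \forall mu \near (1 : R)^'-, 0 < mu < 1.
  near=> mu; apply/andP; split.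
    by near: mu; exact: nbhs_left_gt.
  by near: mu; exact: nbhs_left_lt.
have E : \forall mu \near (1 : R)^'-, (W mu)^-1 * D1 mu * D2 mu = density nu mu y.
  apply: filterS mu01 => mu /andP[m0 m1].
  have d0 : delta mu != 0.
    by rewrite /delta mulf_neq0 ?invr_neq0 ?mulf_neq0 ?gt_eqF// subr_gt0.
  rewrite /density -/(D2 mu); congr (_ * _).
  have -> : ZN N nu mu = W mu * delta mu ^+ p by rewrite /ZN /W -/G -/p; ring.
  have -> : \det (\matrix_(i < N, j < N)
      (y i `^ (j%:R / 2) * besselI j (2 * delta mu * Num.sqrt (y i)))) = delta mu ^+ p * D1 mu.
    rewrite /p -prod_expr_ord -det_col_scale; congr (\det _).
    apply/matrixP => i j; rewrite !mxE -!mulrA mulVf ?mulr1// expf_neq0//.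
  by rewrite (invfM (W mu)) -[RHS]mulrA mulKf// expf_neq0.
have ca : alpha mu @[mu --> (1 : R)^'-] --> (1 : R).
  have h : {for 1, continuous (@alpha R)}.
    have -> : @alpha R = (fun mu => (1 + mu) * (2 * mu)^-1) by apply/funext.
    rewrite /prop_for; cont_step; first by cont.
    by apply: (@cont_inv _ (fun mu => 2 * mu)); [rewrite mulr1|cont].
  have e : alpha (1 : R) = 1 by rewrite /alpha mulr1 divff// addr_eq0 eq_sym lt_eqF// (lt_trans _ ltr01)// ltrN10.
  by rewrite -[X in _ --> X]e; apply: cvg_at_left_filter; exact: h.
have cd : delta mu @[mu --> (1 : R)^'-] --> (0 : R).
  have h : {for 1, continuous (@delta R)}.
    have -> : @delta R = (fun mu => (1 - mu) * (2 * mu)^-1) by apply/funext.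
    rewrite /prop_for; cont_step; first by cont.
    by apply: (@cont_inv _ (fun mu => 2 * mu)); [rewrite mulr1|cont].
  have e : delta (1 : R) = 0 by rewrite /delta subrr mul0r.
  by rewrite -[X in _ --> X]e; apply: cvg_at_left_filter; exact: h.
have cW : W mu @[mu --> (1 : R)^'-] --> N`!%:R / 2 ^+ N * G.
  have -> : N`!%:R / 2 ^+ N * G
      = N`!%:R * 1 ^+ (N * nu + p) / (2 ^+ N * (1 ^+ 2 - 0 ^+ 2) ^+ (N * nu + N ^ 2)) * G.
    by rewrite !expr1n expr0n subr0 expr1n !mulr1.
  apply: cvgMl; apply: cvgM; first by apply: cvgMr; exact: cvg_exprn.
  apply: cvgV.
    by rewrite !expr1n expr0n subr0 expr1n mulr1 expf_neq0.
  by apply: cvgMr; apply: cvg_exprn; apply: cvgB; exact: cvg_exprn.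
have cD1 : D1 mu @[mu --> (1 : R)^'-] --> \det (\matrix_(i < N, j < N) (y i ^+ j / j`!%:R)).
  apply: cvg_det => i j.
  (* One half of the exponent j is already in the density; the other comes from the leading term of
     I_j. *)
  have -> : y i ^+ j / j`!%:R = y i `^ (j%:R / 2) * (Num.sqrt (y i) ^+ j / j`!%:R).
    rewrite mulrA; congr (_ / _).
    by rewrite powR_half ?ltW// -exprMn -expr2 sqr_sqrtr// ltW.
  apply: cvgMr.
  have h := @besselI_small _ j _ (ltW (s0 i)).
  apply: (@cvg_comp _ _ _ (@delta R)
    (fun d => besselI j (2 * d * Num.sqrt (y i)) / d ^+ j) _ (0^'+) _ _ h).
  apply: cvg_to_at_right => //.
  apply: filterS mu01 => mu /andP[m0 m1].
  by rewrite /delta divr_gt0 ?mulr_gt0// subr_gt0.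
have cD2 : D2 mu @[mu --> (1 : R)^'-] --> \det (\matrix_(i < N, j < N)
      (y i `^ ((j + nu)%:R / 2) * besselK (j + nu) (2 * Num.sqrt (y i)))).
  apply: cvg_det => i j; apply: cvgMr.
  have x0 : 0 < 2 * Num.sqrt (y i) by rewrite mulr_gt0.
  have h := @besselK_cvg_right _ (j + nu) _ x0.
  apply: (@cvg_comp _ _ _ (fun mu => 2 * alpha mu * Num.sqrt (y i)) (besselK (j + nu))
    _ ((2 * Num.sqrt (y i))^'+) _ _ h).
  apply: cvg_to_at_right.
    have e : 2 * Num.sqrt (y i) = 2 * 1 * Num.sqrt (y i) by rewrite mulr1.
    by rewrite [X in _ --> X]e; apply: cvgMl; apply: cvgMr.
  apply: filterS mu01 => mu /andP[m0 m1].
  rewrite ltr_pM2r// -[ltLHS]mulr1 ltr_pM2l// /alpha ltr_pdivlMr ?mulr_gt0//; lra.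
apply: (cvg_trans (near_eq_cvg E)).
apply: cvgM => //; apply: cvgM => //; apply: cvgV => //.
rewrite mulf_neq0// ?mulf_neq0 ?invr_neq0 ?expf_neq0 ?pnatr_eq0 -?lt0n ?fact_gt0//.
by apply/prodf_neq0 => j _; rewrite addSn !Gamma_nat mulf_neq0 ?pnatr_eq0 -?lt0n ?fact_gt0.
Unshelve. all: by end_near.
Qed.

(** Feeds the asymptotics: with g mu = (1 - mu) s or (1 + mu) s this is the scale r for which 2 /
    r^2 is the argument of I or K. *)
Lemma cvg_sqrt_ratio0 (g : R -> R) (a : R) : 0 < a -> g mu @[mu --> (0 : R)^'+] --> a ->
  Num.sqrt (2 * mu / g mu) @[mu --> (0 : R)^'+] --> (0 : R)^'+.
Proof.
move=> a0 ga; have cm : (mu : R) @[mu --> (0 : R)^'+] --> (0 : R).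
  by apply: cvg_at_right_filter; exact: cvg_id.
apply: cvg_to_at_right.
  rewrite -[X in _ --> X](@sqrtr0 R).
  apply: continuous_cvg; first exact: sqrt_continuous.
  have e : 0 = 2 * 0 * a^-1 by rewrite mulr0 mul0r.
  rewrite [X in _ --> X]e.
  by apply: cvgM; [exact: cvgMr|apply: cvgV => //; rewrite gt_eqF].
near=> mu.
have m0 : 0 < mu by near: mu; exact: nbhs_right_gt.
have g0 : 0 < g mu by near: mu; exact: (cvgr_gt _ ga).
by rewrite sqrtr_gt0 divr_gt0// mulr_gt0.
Unshelve. all: by end_near.
Qed.

Lemma density_cvg0 (N nu : nat) (y : 'I_N -> R) : (0 < N)%N -> (forall i, 0 < y i) ->
  density nu mu y @[mu --> (0 : R)^'+] -->
  2 ^+ (N * (nu + N - 1))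
  / (N`!%:R * \prod_(j < N) (Gamma (R := R) j.+1%:R * Gamma (R := R) (j.+1 + nu)%:R))
  * (\det (\matrix_(i < N, j < N) y i `^ (j%:R / 2))) ^+ 2
  * \prod_(i < N) (y i `^ ((nu%:R - 1) / 2) * expR (- 2 * y i `^ (1 / 2))).
Proof.
move=> N0 y0.
pose s i := Num.sqrt (y i).
have s0 i : 0 < s i by rewrite sqrtr_gt0.
set G := \prod_(j < N) _; set p := ((N * N.-1) %/ 2)%N.
(* [a] and [d] are mu alpha and mu delta, both with limit 1 / 2. *)
pose a (mu : R) := (1 + mu) / 2; pose d (mu : R) := (1 - mu) / 2.
pose V (mu : R) := N`!%:R * a mu ^+ (N * nu + p) * d mu ^+ p / 2 ^+ N * G.
pose rI (mu : R) i := Num.sqrt (2 * mu / ((1 - mu) * s i)).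
pose rK (mu : R) i := Num.sqrt (2 * mu / ((1 + mu) * s i)).
pose hI (j : nat) (r : R) := expR (- (2 / r ^+ 2)) * besselI j (2 / r ^+ 2) / r.
pose hK (j : nat) (r : R) := expR (2 / r ^+ 2) * besselK j (2 / r ^+ 2) / r.
pose D1 (mu : R) := \det (\matrix_(i < N, j < N) (s i ^+ j * hI j (rI mu i))).
pose D2 (mu : R) := \det (\matrix_(i < N, j < N) (s i ^+ (j + nu) * hK (j + nu)%N (rK mu i))).
(* The product of all row factors taken out of the two determinants, divided by mu^N. *)
pose Q (mu : R) := \prod_i (2 / (s i * Num.sqrt ((1 - mu) * (1 + mu))) * expR (- (2 * s i))).
have mu01 : \forall mu \near (0 : R)^'+, 0 < mu < 1.
  near=> mu; apply/andP; split.
    by near: mu; exact: nbhs_right_gt.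
  by near: mu; exact: nbhs_right_lt.
have E : \forall mu \near (0 : R)^'+, (V mu)^-1 * Q mu * D1 mu * D2 mu = density nu mu y.
  apply: filterS mu01 => mu /andP[m0 m1].
  have om0 : 0 < 1 - mu by rewrite subr_gt0.
  have op0 : 0 < 1 + mu by rewrite addr_gt0.
  have rI0 i : 0 < rI mu i by rewrite sqrtr_gt0 divr_gt0 ?mulr_gt0.
  have rK0 i : 0 < rK mu i by rewrite sqrtr_gt0 divr_gt0 ?mulr_gt0.
  have rI2 i : 2 / rI mu i ^+ 2 = 2 * delta mu * s i.
    rewrite sqr_sqrtr; last by rewrite divr_ge0 ?mulr_ge0 ?ltW.
    by rewrite /delta; field; rewrite !gt_eqF// lexx.
  have rK2 i : 2 / rK mu i ^+ 2 = 2 * alpha mu * s i.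
    rewrite sqr_sqrtr; last by rewrite divr_ge0 ?mulr_ge0 ?ltW.
    by rewrite /alpha; field; rewrite !gt_eqF.
  have dI : \det (\matrix_(i < N, j < N) (y i `^ (j%:R / 2) * besselI j (2 * delta mu * Num.sqrt (y i))))
      = \prod_i (expR (2 * delta mu * s i) * rI mu i) * D1 mu.
    rewrite -det_row_scale; congr (\det _); apply/matrixP => i j; rewrite !mxE.
    rewrite powR_half ?ltW// /hI rI2 expRN -/(s i).
    have := expR_gt0 (2 * delta mu * s i); set e := expR _ => e0.
    by have := rI0 i; set r := rI _ _ => r0; field; rewrite !gt_eqF.
  have dK : \det (\matrix_(i < N, j < N) (y i `^ ((j + nu)%:R / 2) * besselK (j + nu) (2 * alpha mu * Num.sqrt (y i))))
      = \prod_i (expR (- (2 * alpha mu * s i)) * rK mu i) * D2 mu.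
    rewrite -det_row_scale; congr (\det _); apply/matrixP => i j; rewrite !mxE.
    rewrite powR_half ?ltW// /hK rK2 expRN -/(s i).
    have := expR_gt0 (2 * alpha mu * s i); set e := expR _ => e0.
    by have := rK0 i; set r := rK _ _ => r0; field; rewrite !gt_eqF.
  have ZE : ZN N nu mu = mu ^+ N * V mu.
    (* Twice p is N (N - 1), so of the power of mu coming from alpha^2 - delta^2 = 1 / mu, the
       denominators of alpha and delta leave exactly mu^N. *)
    have qE : (N * nu + N ^ 2 = N * nu + p + p + N)%N.
      have : (p + p = N * N.-1)%N.
        by rewrite /p divn2 addnn -[RHS]odd_double_half oddM; case: (N) => [|n] //=; rewrite andNb.
      by case: (N) N0 => [|n]//= _; nia.
    have aE : alpha mu = a mu / mu by rewrite /alpha /a; field; rewrite gt_eqF.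
    have dE : delta mu = d mu / mu by rewrite /delta /d; field; rewrite gt_eqF.
    have adE : alpha mu ^+ 2 - delta mu ^+ 2 = mu^-1.
      by rewrite /alpha /delta; field; rewrite gt_eqF.
    rewrite /ZN -/G -/p adE aE dE qE /V !expr_div_n !exprD.
    rewrite !exprVn; field.
    by rewrite !expf_neq0 ?gt_eqF.
  have PQ : \prod_i (expR (2 * delta mu * s i) * rI mu i) * \prod_i (expR (- (2 * alpha mu * s i)) * rK mu i)
      = mu ^+ N * Q mu.
    rewrite -big_split /= -[in mu ^+ N](card_ord N) -prodr_const -big_split /=.
    apply: eq_bigr => i _.
    (* By alpha - delta = 1 the growth of I cancels the decay of K up to exp(- 2 s). *)
    have -> : - (2 * alpha mu * s i) = - (2 * delta mu * s i) - 2 * s i.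
      by rewrite /alpha /delta; field; rewrite gt_eqF.
    have rr : rI mu i * rK mu i = 2 * mu / s i * (Num.sqrt ((1 - mu) * (1 + mu)))^-1.
      rewrite /rI /rK -sqrtrM; last by rewrite divr_ge0 ?mulr_ge0 ?ltW.
      have -> : 2 * mu / ((1 - mu) * s i) * (2 * mu / ((1 + mu) * s i))
          = (2 * mu / s i) ^+ 2 * ((1 - mu) * (1 + mu))^-1.
        by field; rewrite !gt_eqF.
      rewrite sqrtrM ?sqr_ge0// sqrtr_sqr ger0_norm ?sqrtrV ?mulr_ge0 ?ltW//.
      by rewrite invr_gt0.
    have ee : expR (2 * delta mu * s i) * expR (- (2 * delta mu * s i)) = 1.
      by rewrite expRN divff// gt_eqF// expR_gt0.
    rewrite expRD.
    transitivity ((expR (2 * delta mu * s i) * expR (- (2 * delta mu * s i)))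
      * (rI mu i * rK mu i) * expR (- (2 * s i))); first by ring.
    rewrite ee rr mul1r invfM; ring.
  rewrite /density dI dK ZE.
  transitivity ((mu ^+ N * V mu)^-1 * (mu ^+ N * Q mu) * D1 mu * D2 mu); last first.
    by rewrite -PQ; ring.
  congr (_ * _ * _).
  by rewrite (invfM (mu ^+ N)) mulrACA mulVf ?mul1r// expf_neq0// gt_eqF.
have cm : (mu : R) @[mu --> (0 : R)^'+] --> (0 : R).
  by apply: cvg_at_right_filter; exact: cvg_id.
have cp : 1 + mu @[mu --> (0 : R)^'+] --> (1 : R).
  by rewrite -[X in _ --> X]addr0; apply: cvgD => //; exact: cvg_cst.
have cn : 1 - mu @[mu --> (0 : R)^'+] --> (1 : R).
  by rewrite -[X in _ --> X]subr0; apply: cvgB => //; exact: cvg_cst.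
have cV : V mu @[mu --> (0 : R)^'+] --> N`!%:R * (1 / 2) ^+ (N * nu + p) * (1 / 2) ^+ p / 2 ^+ N * G.
  apply: cvgMl; apply: cvgMl; apply: cvgM; first (apply: cvgMr); apply: cvg_exprn; exact: cvgMl.
have cQ : Q mu @[mu --> (0 : R)^'+] --> \prod_i (2 / s i * expR (- (2 * s i))).
  apply: cvg_prod_seq => i; apply: cvgMl; apply: cvgMr.
  have e : s i = s i * Num.sqrt (1 * 1) by rewrite mulr1 sqrtr1 mulr1.
  apply: cvgV; first by rewrite gt_eqF.
  rewrite [X in _ --> X]e; apply: cvgMr; apply: continuous_cvg; first exact: sqrt_continuous.
  exact: cvgM.
have cD1 : D1 mu @[mu --> (0 : R)^'+] --> \det (\matrix_(i < N, j < N) (s i ^+ j * (Num.sqrt pi / 2 / pi))).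
  apply: cvg_det => i j; apply: cvgMr.
  have h := @besselI_asymptotics R j.
  apply: (@cvg_comp _ _ _ (fun mu => rI mu i) (hI j) _ (0^'+) _ _ h).
  apply: (@cvg_sqrt_ratio0 _ (1 * s i)); first by rewrite mul1r.
  exact: cvgMl.
have cD2 : D2 mu @[mu --> (0 : R)^'+] --> \det (\matrix_(i < N, j < N) (s i ^+ (j + nu) * (Num.sqrt pi / 2))).
  apply: cvg_det => i j; apply: cvgMr.
  have h := @besselK_asymptotics R (j + nu).
  apply: (@cvg_comp _ _ _ (fun mu => rK mu i) (hK (j + nu)%N) _ (0^'+) _ _ h).
  apply: (@cvg_sqrt_ratio0 _ (1 * s i)); first by rewrite mul1r.
  exact: cvgMl.
have G0 : G != 0.
  by apply/prodf_neq0 => j _; rewrite addSn !Gamma_nat mulf_neq0 ?pnatr_eq0 -?lt0n ?fact_gt0.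
have fN0 : N`!%:R != 0 :> R by rewrite pnatr_eq0 -lt0n fact_gt0.
have h2 (k : nat) : (2 : R) ^+ k != 0 by rewrite expf_neq0.
have h12 (k : nat) : (1 / 2 : R) ^+ k != 0 by rewrite expf_neq0// mulf_neq0// invr_neq0.
set L := (X in _ --> X).
pose D := \det (\matrix_(i < N, j < N) (s i ^+ j)).
pose PS := \prod_i (s i ^+ nu); pose PI := \prod_i s i; pose PE := \prod_i expR (- (2 * s i)).
have -> : L = (N`!%:R * (1 / 2) ^+ (N * nu + p) * (1 / 2) ^+ p / 2 ^+ N * G)^-1
   * (\prod_i (2 / s i * expR (- (2 * s i))))
   * \det (\matrix_(i < N, j < N) (s i ^+ j * (Num.sqrt pi / 2 / pi)))
   * \det (\matrix_(i < N, j < N) (s i ^+ (j + nu) * (Num.sqrt pi / 2))).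
  have D1E : \det (\matrix_(i < N, j < N) (s i ^+ j * (Num.sqrt pi / 2 / pi)))
      = (Num.sqrt pi / 2 / pi) ^+ N * D.
    by rewrite (det_col_scale (fun=> Num.sqrt pi / 2 / pi)) prodr_const card_ord.
  have D2E : \det (\matrix_(i < N, j < N) (s i ^+ (j + nu) * (Num.sqrt pi / 2)))
      = PS * (Num.sqrt pi / 2) ^+ N * D.
    rewrite -[in _ ^+ N](card_ord N) -prodr_const -big_split /= -det_row_scale.
    by congr (\det _); apply/matrixP => i j; rewrite !mxE exprD; ring.
  have QE : \prod_i (2 / s i * expR (- (2 * s i))) = 2 ^+ N / PI * PE.
    by rewrite big_split big_split /= prodfV prodr_const card_ord.
  have LE : \prod_(i < N) (y i `^ ((nu%:R - 1) / 2) * expR (- 2 * y i `^ (1 / 2)))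
      = PS / PI * PE.
    rewrite -prodfV -!big_split; apply: eq_bigr => i _ /=.
    rewrite mul1r powR12_sqrt ?ltW// -/(s i) mulNr; congr (_ * _).
    rewrite mulrBl mul1r powRD; last by apply/implyP => _; rewrite gt_eqF.
    by rewrite powRN powR_half ?ltW// powR12_sqrt ?ltW.
  rewrite D1E D2E QE /L LE.
  have -> : \matrix_(i < N, j < N) y i `^ (j%:R / 2) = \matrix_(i < N, j < N) (s i ^+ j).
    by apply/matrixP => i j; rewrite !mxE powR_half ?ltW.
  rewrite -/D.
  (* Per row the two Laplace constants multiply to 1 / 4: pi drops out. *)
  have cc : (Num.sqrt pi / 2 / pi) ^+ N * (Num.sqrt pi / 2) ^+ N = (2 ^+ N * 2 ^+ N)^-1.
    rewrite -!exprMn -exprVn; congr (_ ^+ _).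
    have := pi_gt0 R; have : Num.sqrt pi * Num.sqrt pi = pi.
      by rewrite -expr2 sqr_sqrtr// pi_ge0.
    move: (Num.sqrt pi) => q <- qq.
    have q0 : q != 0 by apply: contraTneq qq => ->; rewrite mul0r ltxx.
    by field.
  (* The halves in the limit of [V] give 2^(N nu + 2 p); the 2^N of [V] and the 2^N of [Q] are
     consumed by the constants 1 / 4. *)
  have kE : (N * (nu + N - 1) = N * nu + p + p)%N.
    have : (p + p = N * N.-1)%N.
      by rewrite /p divn2 addnn -[RHS]odd_double_half oddM; case: (N) => [|n] //=; rewrite andNb.
    by case: (N) N0 => [|n]//= _; nia.
  set X1 := (_ / pi) ^+ N in cc *; set X2 := (Num.sqrt pi / 2) ^+ N in cc *.
  rewrite kE [2 ^+ _]exprD !(expr_div_n 1) !expr1n.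
  have PI0 : PI != 0 by apply/prodf_neq0 => i _; rewrite gt_eqF.
  transitivity ((2 ^+ (N * nu + p) * 2 ^+ p) * 2 ^+ N * 2 ^+ N
    * (X1 * X2) / (N`!%:R * G)
    * D ^+ 2 * (PS / PI * PE)).
    by rewrite cc; field; rewrite !h2 fN0 G0 PI0.
  move: X1 X2 {cc} => X1 X2.
  by field; rewrite !h2 fN0 G0 PI0.
apply: (cvg_trans (near_eq_cvg E)).
apply: cvgM => //; apply: cvgM => //; apply: cvgM => //; apply: cvgV => //.
by rewrite !mulf_neq0// invr_neq0.
Unshelve. all: by end_near.
Qed.

End Density.

Lemma det_meijerG (R : realType) (N nu : nat) (c : R) (y : 'I_N -> R) :
  0 < c -> (forall i, 0 < y i) ->
  \det (\matrix_(i < N, j < N) meijerG2002 c 0 (j + nu)%:R (y i))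
  = (2 ^+ N * \det (\matrix_(i < N, j < N)
      (y i `^ ((j + nu)%:R / 2) * besselK (j + nu) (2 * Num.sqrt (y i)))))%:C.
Proof.
move=> c0 y0; rewrite -detZ -det_map_mx; congr (\det _).
by apply/matrixP => i j; rewrite !mxE meijerGE.
Qed.

Theorem mainTheorem2 (R : realType) (M N nu : nat) (y : 'I_N -> R) :
  (1 <= N)%N -> (N <= M)%N -> nu = (M - N)%N -> (forall i, 0 < y i) ->
  (forall c : R, 0 < c ->
    ((density nu mu y)%:C : R[i]^o) @[mu --> (1 : R)^'-] -->
      ((\det (\matrix_(i < N, j < N) y i ^+ j)
         / (N`!%:R * \prod_(j < N) (Gamma (R := R) j.+1%:R ^+ 2
                                    * Gamma (R := R) (j.+1 + nu)%:R)))%:C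
       * \det (\matrix_(i < N, j < N) meijerG2002 c 0 (j + nu)%:R (y i))
       : R[i]^o))
  /\
  density nu mu y @[mu --> (0 : R)^'+] -->
    2 ^+ (N * (M - 1))
    / (N`!%:R * \prod_(j < N) (Gamma (R := R) j.+1%:R
                               * Gamma (R := R) (j.+1 + nu)%:R))
    * (\det (\matrix_(i < N, j < N) y i `^ (j%:R / 2))) ^+ 2
    * \prod_(i < N) (y i `^ ((nu%:R - 1) / 2) * expR (- 2 * y i `^ (1 / 2))).
Proof.
move=> N1 NM nuE y0; split; last first.
  have -> : (M - 1 = nu + N - 1)%N by rewrite nuE subnK.
  exact: density_cvg0.
move=> c c0; set DK := \det (\matrix_(i < N, j < N)
  (y i `^ ((j + nu)%:R / 2) * besselK (j + nu) (2 * Num.sqrt (y i)))).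
(* The 2^N from the Meijer functions is the one in the denominator of [ZN], and the j! of the
   columns supply the second factor Gamma(j + 1) of the squares. *)
suff E : \det (\matrix_(i < N, j < N) y i ^+ j)
    / (N`!%:R * \prod_(j < N) (Gamma (R := R) j.+1%:R ^+ 2 * Gamma (R := R) (j.+1 + nu)%:R))
    * (2 ^+ N * DK)
  = (N`!%:R / 2 ^+ N * \prod_(j < N) (Gamma (R := R) j.+1%:R * Gamma (R := R) (j.+1 + nu)%:R))^-1
    * \det (\matrix_(i < N, j < N) (y i ^+ j / j`!%:R)) * DK.
  rewrite det_meijerG// -rmorphM E.
  by apply: cvg_real_complex; exact: density_cvg1.
rewrite (det_col_scale (fun j : 'I_N => j`!%:R^-1) (fun i j => y i ^+ j)).
set Dy := \det _; set G := \prod_(j < N) (Gamma _ * _).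
have -> : \prod_(j < N) (Gamma (R := R) j.+1%:R ^+ 2 * Gamma (R := R) (j.+1 + nu)%:R)
    = \prod_(j < N) j`!%:R * G.
  rewrite /G -big_split; apply: eq_bigr => j _.
  by rewrite /= expr2 -mulrA Gamma_nat.
rewrite prodfV; set F := \prod_(j < N) _.
have fn0 k : k`!%:R != 0 :> R by rewrite pnatr_eq0 -lt0n fact_gt0.
have F0 : F != 0 by apply/prodf_neq0.
have G0 : G != 0.
  by apply/prodf_neq0 => j _; rewrite addSn !Gamma_nat mulf_neq0.
have h2 : (2 : R) ^+ N != 0 by rewrite expf_neq0.
by field; rewrite h2 fn0 F0 G0.
Qed.
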